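(* Let $(M,\pi_M,E_M)$ be a real analytic Jacobi manifold which is contact on a dense open subset and whose singular locus contains a submanifold of codimension $1$ of $M$. Then $(M,\pi_M,E_M)$ does not admit a semi-connected (real analytic) contact resolution.
   Context: Manifolds, structures and maps are real analytic, and all manifolds, including the sources of resolutions, are assumed separable (second countable). A Jacobi structure on a manifold $M$ is a pair $(\pi_M,E_M)$ of a bivector field and a vector field such that $[\pi_M,\pi_M]=2E_M\wedge\pi_M$ and $[E_M,\pi_M]=0$, with the sign of the Schouten bracket normalized so that this is equivalent to the Jacobi identity for $\{f,g\}=\pi_M(df,dg)+fE_M[g]-gE_M[f]$. A contact manifold of dimension $2n+1$ is regarded as a manifold $\Sigma$ with a Jacobi structure $(\Pi_\Sigma,E_\Sigma)$ such that $E_\Sigma\wedge\Pi_\Sigma^n$ vanishes at no point; a Jacobi structure on $M$ is contact on an open subset $U$ if $\dim M=2n+1$ and $E_M\wedge\pi_M^n$ vanishes at no point of $U$. The singular locus of such a structure is the set of points of $M$ where $E_M\wedge\pi_M^n=0$. A Jacobi morphism $\varphi:\Sigma\to M$ is a map projecting $\Pi_\Sigma$ and $E_\Sigma$ onto $\pi_M$ and $E_M$, i.e. $\wedge^2T_\sigma\varphi(\Pi_\Sigma|_\sigma)=\pi_M|_{\varphi(\sigma)}$ and $T_\sigma\varphi(E_\Sigma|_\sigma)=E_M|_{\varphi(\sigma)}$ for all $\sigma\in\Sigma$. A contact resolution of a Jacobi manifold $M$ is a contact manifold $\Sigma$ of the same dimension together with a surjective Jacobi morphism $\varphi:\Sigma\to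 M$; it is semi-connected if no connected component of $\Sigma$ is mapped by $\varphi$ into the singular locus of $(\pi_M,E_M)$. Submanifolds are nonempty. *)

(* Defs.v *)
From mathcomp Require Import all_boot all_order all_algebra all_fingroup.
From mathcomp Require Import all_classical all_reals all_analysis.
Import Order.TTheory GRing.Theory Num.Theory.
Import numFieldNormedType.Exports.

Set Implicit Arguments.
Unset Strict Implicit.
Unset Printing Implicit Defensive.

Local Open Scope classical_set_scope.
Local Open Scope ring_scope.

Definition monomial (R : realType) (d : nat) (a : {ffun 'I_d -> nat})
    (h : 'rV[R]_d) : R :=
  \prod_(i < d) h ord0 i ^+ a i.

(* Around x, f is the sum of an absolutely convergent power series; since the
   family is summable, it may be summed along the cubes {0, ..., N-1}^d. *)
Definition analytic_at (R : realType) (d : nat) (f : 'rV[R]_d -> R)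
    (x : 'rV[R]_d) : Prop :=
  exists (c : {ffun 'I_d -> nat} -> R) (r : R), 0 < r /\
  forall y : 'rV[R]_d, ball x r y ->
    summable [set: {ffun 'I_d -> nat}]
      (fun a => (c a * monomial a (y - x))%:E) /\
    (fun N : nat => \sum_(b : {ffun 'I_d -> 'I_N})
       let a := [ffun i => nat_of_ord (b i)] in c a * monomial a (y - x))
      @ \oo --> f y.

Definition analytic_mx_at (R : realType) (d p q : nat)
    (f : 'rV[R]_d -> 'M[R]_(p, q)) (x : 'rV[R]_d) : Prop :=
  forall i j, analytic_at (fun y => f y i j) x.

(* cmap is meaningful on cdom only, and cinv on cmap @` cdom only. *)
Record chart (R : realType) (d : nat) (T : topologicalType) := Chart {
  cdom : set T;
  cmap : T -> 'rV[R]_d;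
  cinv : 'rV[R]_d -> T;
  cdom_open : open cdom;
  cimg_open : open (cmap @` cdom);
  cmap_continuous : forall p, cdom p -> {for p, continuous cmap};
  cinv_continuous : forall x, (cmap @` cdom) x -> {for x, continuous cinv};
  cmapK : forall p, cdom p -> cinv (cmap p) = p }.

Definition coord_rep (R : realType) (d e : nat) (T U : topologicalType)
    (a : chart R d T) (b : chart R e U) (f : T -> U) : 'rV[R]_d -> 'rV[R]_e :=
  fun x => cmap b (f (cinv a x)).

Definition analytic_transition (R : realType) (d : nat) (T : topologicalType)
    (a b : chart R d T) : Prop :=
  forall p, cdom a p -> cdom b p ->
    analytic_mx_at (coord_rep a b id) (cmap a p).

Record analytic_manifold (R : realType) (d : nat) := AnalyticManifold {
  mcarrier :> topologicalType;
  mhausdorff : hausdorff_space mcarrier;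
  msecond_countable : @second_countable mcarrier;
  matlas : set (chart R d mcarrier);
  matlas_cover : forall p, exists2 a, matlas a & cdom a p;
  matlas_analytic : forall a b, matlas a -> matlas b ->
    analytic_transition a b }.

Definition analytic_map (R : realType) (d e : nat) (M : analytic_manifold R d)
    (N : analytic_manifold R e) (f : M -> N) : Prop :=
  continuous f /\
  forall (a : chart R d M) (b : chart R e N) (p : M),
    matlas a -> matlas b -> cdom a p -> cdom b (f p) ->
    analytic_mx_at (coord_rep a b f) (cmap a p).

(* Matrix of T_p f in the charts a and b. As for the library's jacobian, it
   acts on the right of row vectors: its (i, j) entry is the i-th partial
   derivative of the j-th component. *)
Definition tangent_mx (R : realType) (d e : nat) (T U : topologicalType)
    (a : chart R d T) (b : chart R e U) (f : T -> U) (p : T) : 'M[R]_(d, e) :=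
  jacobian (coord_rep a b f) (cmap a p).

Definition push_vector (R : realType) (d e : nat) (J : 'M[R]_(d, e))
    (v : 'rV[R]_d) : 'rV[R]_e := v *m J.

Definition push_bivector (R : realType) (d e : nat) (J : 'M[R]_(d, e))
    (P : 'M[R]_d) : 'M[R]_e := J^T *m P *m J.

(* vcoord X a p is the row of components of X_p in the chart a; only its values
   for a in the atlas and p in the domain of a are meaningful. *)
Record vector_field (R : realType) (d : nat) (M : analytic_manifold R d) :=
  VectorField {
  vcoord : chart R d M -> M -> 'rV[R]_d;
  vcoord_analytic : forall a p, matlas a -> cdom a p ->
    analytic_mx_at (fun x => vcoord a (cinv a x)) (cmap a p);
  vcoord_change : forall a b p, matlas a -> matlas b -> cdom a p -> cdom b p ->
    vcoord b p = push_vector (tangent_mx a b id p) (vcoord a p) }.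

(* bcoord P a p i j = P_p(dx_i, dx_j), where x is the chart a. *)
Record bivector_field (R : realType) (d : nat) (M : analytic_manifold R d) :=
  BivectorField {
  bcoord : chart R d M -> M -> 'M[R]_d;
  bcoord_antisym : forall a p, matlas a -> cdom a p ->
    (bcoord a p)^T = - bcoord a p;
  bcoord_analytic : forall a p, matlas a -> cdom a p ->
    analytic_mx_at (fun x => bcoord a (cinv a x)) (cmap a p);
  bcoord_change : forall a b p, matlas a -> matlas b -> cdom a p -> cdom b p ->
    bcoord b p = push_bivector (tangent_mx a b id p) (bcoord a p) }.

Definition dpartial (R : realType) (d : nat) (l : 'I_d) (f : 'rV[R]_d -> R)
    (x : 'rV[R]_d) : R :=
  'D_(delta_mx ord0 l : 'rV[R]_d) f x.

(* Components on (dx_i, dx_j, dx_k) of the Schouten bracket [P, Q] of bivector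
   fields on R^d. The sign is the one for which [P, P] = 2 E /\ P, together with
   [E, P] = 0, is the Jacobi identity for {f, g} = P(df, dg) + f E[g] - g E[f]:
   at a common zero of the coordinates x_i, x_j, x_k, the Jacobiator of
   (x_i, x_j, x_k) is ([P, P]/2 - E /\ P)(dx_i, dx_j, dx_k). *)
Definition schouten2 (R : realType) (d : nat) (P Q : 'rV[R]_d -> 'M[R]_d)
    (x : 'rV[R]_d) (i j k : 'I_d) : R :=
  let t i j k := \sum_(l < d)
    (P x l k * dpartial l (fun y => Q y i j) x +
     Q x l k * dpartial l (fun y => P y i j) x) in
  t i j k + t j k i + t k i j.

(* Components of the Schouten bracket [E, P], i.e. of the Lie derivative of the
   bivector field P along the vector field E. *)
Definition schouten1 (R : realType) (d : nat) (E : 'rV[R]_d -> 'rV[R]_d)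
    (P : 'rV[R]_d -> 'M[R]_d) (x : 'rV[R]_d) (i j : 'I_d) : R :=
  \sum_(l < d)
    (E x ord0 l * dpartial l (fun y => P y i j) x
     - P x l j * dpartial l (fun y => E y ord0 i) x
     - P x i l * dpartial l (fun y => E y ord0 j) x).

(* Components on (dx_i, dx_j, dx_k) of E /\ P. *)
Definition wedge12 (R : realType) (d : nat) (E : 'rV[R]_d) (P : 'M[R]_d)
    (i j k : 'I_d) : R :=
  E ord0 i * P j k + E ord0 j * P k i + E ord0 k * P i j.

Record jacobi_structure (R : realType) (d : nat) (M : analytic_manifold R d) :=
  JacobiStructure {
  jpi : bivector_field M;
  jE : vector_field M;
  jacobi_pi_pi : forall a p i j k, matlas a -> cdom a p ->
    let P := fun x => bcoord jpi a (cinv a x) in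
    schouten2 P P (cmap a p) i j k =
      2 * wedge12 (vcoord jE a p) (bcoord jpi a p) i j k;
  jacobi_E_pi : forall a p i j, matlas a -> cdom a p ->
    schouten1 (fun x => vcoord jE a (cinv a x))
              (fun x => bcoord jpi a (cinv a x)) (cmap a p) i j = 0 }.

(* The coefficient of E /\ P^n in the one-dimensional space of multivectors of
   degree 2n+1, i.e. its value on (dx_0, ..., dx_2n). *)
Definition wedge_top (R : realType) (n : nat) (E : 'rV[R]_(n.*2.+1))
    (P : 'M[R]_(n.*2.+1)) : R :=
  (2 ^+ n)^-1 * \sum_(s : 'S_(n.*2.+1))
    (-1) ^+ s * E ord0 (s ord0) *
    \prod_(j < n) P (s (inord j.*2.+1)) (s (inord j.*2.+2)).

Definition singular_locus (R : realType) (n : nat)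
    (M : analytic_manifold R n.*2.+1) (J : jacobi_structure M) : set M :=
  [set p | exists a : chart R n.*2.+1 M, [/\ matlas a, cdom a p &
     wedge_top (vcoord (jE J) a p) (bcoord (jpi J) a p) = 0]].

Definition contact_on (R : realType) (n : nat)
    (M : analytic_manifold R n.*2.+1) (J : jacobi_structure M)
    (U : set M) : Prop :=
  forall p (a : chart R n.*2.+1 M), U p -> matlas a -> cdom a p ->
    wedge_top (vcoord (jE J) a p) (bcoord (jpi J) a p) != 0.

(* Embedded analytic submanifold of codimension k (nonempty), through slice
   charts belonging to the maximal atlas. *)
Definition submanifold (R : realType) (d : nat) (M : analytic_manifold R d)
    (k : nat) (N : set M) : Prop :=
  [/\ N !=set0, (k <= d)%N &
   forall p, N p -> exists c : chart R d M,
     [/\ cdom c p,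
         forall a, matlas a ->
           analytic_transition a c /\ analytic_transition c a &
         forall q, cdom c q ->
           (N q <-> forall i : 'I_d, (i < k)%N -> cmap c q ord0 i = 0)]].

Definition jacobi_morphism (R : realType) (d e : nat)
    (S : analytic_manifold R d) (K : jacobi_structure S)
    (M : analytic_manifold R e) (J : jacobi_structure M) (f : S -> M) : Prop :=
  analytic_map f /\
  forall (a : chart R d S) (b : chart R e M) (p : S),
    matlas a -> matlas b -> cdom a p -> cdom b (f p) ->
    push_bivector (tangent_mx a b f p) (bcoord (jpi K) a p) =
      bcoord (jpi J) b (f p) /\
    push_vector (tangent_mx a b f p) (vcoord (jE K) a p) =
      vcoord (jE J) b (f p).

Record contact_resolution (R : realType) (n : nat)
    (M : analytic_manifold R n.*2.+1) (J : jacobi_structure M) :=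
  ContactResolution {
  rsource : analytic_manifold R n.*2.+1;
  rjacobi : jacobi_structure rsource;
  rcontact : contact_on rjacobi [set: rsource];
  rmap : rsource -> M;
  rmap_jacobi : jacobi_morphism rjacobi J rmap;
  rmap_surj : forall q : M, exists p : rsource, rmap p = q }.

Definition semi_connected (R : realType) (n : nat)
    (M : analytic_manifold R n.*2.+1) (J : jacobi_structure M)
    (S : contact_resolution J) : Prop :=
  forall p : rsource S,
    ~ (@rmap _ _ _ _ S @` connected_component [set: rsource S] p
         `<=` singular_locus J).

(* Main.v *)
From HB Require Import structures.
Require Import Defs.
From mathcomp Require Import all_boot all_order all_algebra all_fingroup.
From mathcomp Require Import finmap ring lra.
From mathcomp Require Import all_classical all_reals all_analysis.

(** Let phi : S -> M be a contact resolution. In charts, the coefficient of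
    E /\ pi^n at phi(p) is det(T_p phi) times the coefficient at p
    ([wedge_top_push]), and the latter vanishes nowhere on S. So phi is singular
    exactly over the singular locus.

    Let N be the hypersurface, (x_0, x') slice coordinates of M with
    N = {x_0 = 0}, and (u, v) = (x_0 o phi, x' o phi). The coefficient vanishes
    on N, hence is O(|x_0|), which gives the inequality
      |det d(u, v)| <= C |u|
    near each point of Z = {u = 0} ([rep_determinant_bound]). Since phi is onto,
    v(Z) contains a ball of R^{2n}; the inequality will force v(Z) to be
    Lebesgue null.

    First, u has a finite order of vanishing at each point of Z
    ([rep_not_flat]): otherwise det(T phi), bounded by a multiple of |u|, would
    be flat at that point, hence zero around it by analyticity, hence zero on
    the connected component ([not_locally_singular]), and phi would map this
    component into the singular locus.

    Let m be the order of u at a point q of Z, and let w be a partial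
    derivative of u of order m - 1 with dw(q) <> 0. Expand det d(u, v) along the
    gradient of u, as sum_i c_i d_i u. The inequality bounds it by O(|h|^m), while
    its part of degree m - 1 is that of sum_i c_i(q) d_i u. So this part
    vanishes, and differentiating m - 1 times yields sum_i c_i(q) d_i w(q) = 0: the
    differentials of w and of the components of v are linearly dependent at q
    ([degenerate_at_minimal_order]). In other words, Z is a countable union of
    subsets of smooth hypersurfaces {w = 0}, of dimension 2n, at the points of
    which the restriction of v to the hypersurface is critical ([stratum]). The
    equidimensional case of the theorem of Sard ([null_thin],
    [null_critical_values]) and second countability ([null_lindelof]) show that
    v(Z) is null, whereas a ball is not ([ball_not_null]).

    Analyticity only enters through the bounds |d_s f| <= C K^{|s|} |s|! on
    iterated partial derivatives: they hold for sums of power series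
    ([analytic_at_bounded]), are stable under products ([dboundM]), hence pass
    to det(T phi), and a function that satisfies them and is flat at a point is
    zero around it ([ab_flat]). *)

Import Order.TTheory GRing.Theory Num.Theory.
Import numFieldNormedType.Exports.

Set Implicit Arguments.
Unset Strict Implicit.
Unset Printing Implicit Defensive.

Local Open Scope classical_set_scope.
Local Open Scope ring_scope.

(** * Rows and their norm *)

Section row_norm.
Context {R : realType} {d : nat}.
Implicit Types (x y v : 'rV[R]_d) (r e : R).

Lemma coord_le_norm v i : `|v ord0 i| <= `|v|.
Proof.
rewrite [leRHS]/Num.norm /= mx_normrE; apply/bigmax_geP; right => /=.
by exists (ord0, i).
Qed.

Lemma norm_le_coord v e : 0 <= e -> (forall i, `|v ord0 i| <= e) -> `|v| <= e.
Proof.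
move=> e0 h; rewrite /Num.norm /= mx_normrE; apply/bigmax_leP; split => //.
by move=> [i j] _ /=; rewrite ord1.
Qed.

Lemma rball_normE x r y : ball x r y <-> `|y - x| < r.
Proof. by rewrite -ball_normE /ball_/= distrC. Qed.

Lemma ball_segment x r y z t : 0 <= t -> t <= 1 -> ball x r y -> ball x r z ->
  ball x r (y + t *: (z - y)).
Proof.
move=> t0 t1 /rball_normE xy /rball_normE xz; apply/rball_normE.
have -> : y + t *: (z - y) - x = (1 - t) *: (y - x) + t *: (z - x).
  by rewrite scalerBl scale1r !scalerBr; apply/rowP => i; rewrite !mxE; ring.
apply: le_lt_trans (ler_normD _ _) _; rewrite !normrZ (ger0_norm t0).
rewrite (ger0_norm (_ : 0 <= 1 - t)) ?subr_ge0//.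
have [->|tn1] := eqVneq t 1; first by rewrite subrr mul0r add0r mul1r.
have t1' : 0 < 1 - t by rewrite subr_gt0 lt_neqAle tn1.
have -> : r = (1 - t) * r + t * r by ring.
by rewrite ltr_leD// ?ltr_pM2l// ler_wpM2l// ltW.
Qed.

Lemma cvg_rball x (P : set 'rV[R]_d) : (\forall y \near x, P y) ->
  exists2 r, 0 < r & forall y, ball x r y -> P y.
Proof. by move=> /nbhs_ballP[r r0 h]; exists r. Qed.

End row_norm.

(** * Differential calculus with coordinates *)

Lemma diff_eps (R : realType) (V W : normedModType R) (f : V -> W) (x : V)
    (L : {linear V -> W}) : continuous L ->
  (forall eps, 0 < eps -> \forall y \near x,
     `|f y - f x - L (y - x)| <= eps * `|y - x|) ->
  differentiable f x /\ 'd f x = L :> (V -> W).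
Proof.
move=> Lc h.
have ho : f \o shift x = cst (f x) + L +o_ 0 id.
  apply/eqaddoP => eps e0; near=> k => /=.
  suff : `|f (k + x) - f x - L (k + x - x)| <= eps * `|k + x - x|.
    by rewrite addrK opprD addrA.
  near: k.
  by have := h _ e0; rewrite (near_shift 0) /=; apply: filterS => k /=;
    rewrite subr0.
have dE : 'd f x = L :> (V -> W) by exact: diff_unique.
by split => //; apply/diff_locallyP; split; rewrite dE.
Unshelve. all: by end_near. Qed.

Lemma diff_epsE (R : realType) (V W : normedModType R) (f : V -> W) (x : V) :
  differentiable f x -> forall eps, 0 < eps -> \forall y \near x,
     `|f y - f x - 'd f x (y - x)| <= eps * `|y - x|.
Proof.
move=> df eps e0; have /eqaddoP/(_ _ e0) := diff_locally df.
rewrite [X in _ -> X](near_shift 0) /=; apply: filterS => k /=.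
by rewrite subr0 addrK opprD addrA.
Qed.

Lemma diff_near (R : realType) (V W : normedModType R) (f g : V -> W) (x : V) :
  {near x, f =1 g} -> differentiable f x -> differentiable g x.
Proof.
move=> h df; suff H : forall eps, 0 < eps -> \forall y \near x,
    `|g y - g x - 'd f x (y - x)| <= eps * `|y - x|.
  by have [] := diff_eps (diff_continuous df) H.
move=> eps e0; have fg : f x = g x by exact: nbhs_singleton h.
have H := diff_epsE df e0.
by near=> y; rewrite -fg -(near h y)//; near: y.
Unshelve. all: by end_near. Qed.

Section partials.
Context {R : realType} {d : nat}.
Implicit Types (x y z v : 'rV[R]_d) (U : set 'rV[R]_d) (f g : 'rV[R]_d -> R).

Lemma derive_partials f x v : differentiable f x ->
  'D_v f x = \sum_i v ord0 i * dpartial i f x.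
Proof.
move=> df; rewrite deriveE// {1}[v]row_sum_delta linear_sum.
by apply: eq_bigr => i _; rewrite linearZ /dpartial deriveE.
Qed.

Lemma dpartial_near i f g x : {near x, f =1 g} ->
  dpartial i f x = dpartial i g x.
Proof.
by move=> h; apply: near_eq_derive => //; apply/eqP => /matrixP/(_ ord0 i);
  rewrite !mxE !eqxx => /eqP; rewrite oner_eq0.
Qed.

End partials.

Section mean_value.
Context {R : realType} {d : nat}.
Implicit Types (x y z v : 'rV[R]_d) (f g : 'rV[R]_d -> R).

Lemma is_derive_line f y v (t : R) : differentiable f (y + t *: v) ->
  is_derive t 1 (fun s : R => f (y + s *: v))
    (\sum_i v ord0 i * dpartial i f (y + t *: v)).
Proof.
move=> df.
have dl : is_diff t (fun s : R => y + s *: v) ( *:%R ^~ v).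
  by apply: is_diff_eq; rewrite add0r.
have dfc : is_diff t (f \o (fun s : R => y + s *: v))
    ('d f (y + t *: v) \o ( *:%R ^~ v)).
  exact: is_diff_comp.
apply: DeriveDef.
  by apply: diff_derivable; exact: (@ex_diff _ _ _ _ _ _ _ dfc).
rewrite deriveE; last exact: (@ex_diff _ _ _ _ _ _ _ dfc).
by rewrite (@diff_val _ _ _ _ _ _ _ dfc) /= scale1r -deriveE// derive_partials.
Qed.

Lemma mvt_ball f x r y z : (forall w, ball x r w -> differentiable f w) ->
  ball x r y -> ball x r z ->
  exists2 t : R, 0 <= t <= 1 & f z - f y =
    \sum_i (z - y) ord0 i * dpartial i f (y + t *: (z - y)).
Proof.
move=> df xy xz.
have H (t : R) : 0 <= t -> t <= 1 -> is_derive t 1 (fun s : R => f (y + s *: (z - y)))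
    (\sum_i (z - y) ord0 i * dpartial i f (y + t *: (z - y))).
  by move=> t0 t1; apply: is_derive_line; apply: df; exact: ball_segment.
have [|/=|t] := @MVT_segment R (fun s : R => f (y + s *: (z - y)))
  (fun t => \sum_i (z - y) ord0 i * dpartial i f (y + t *: (z - y))) 0 1 ler01.
- by move=> t; rewrite in_itv/= => /andP[t0 t1]; apply: H; exact: ltW.
- apply: derivable_within_continuous => t; rewrite in_itv/= => /andP[t0 t1].
  exact: (@ex_derive _ _ _ _ _ _ _ (H t t0 t1)).
rewrite in_itv/= scale0r addr0 scale1r subr0 mulr1 [y + (z - y)]addrC subrK => t01 ->.
by exists t.
Qed.

Lemma sum_coord_le v (c : 'I_d -> R) C : (forall i, `|c i| <= C) ->
  `|\sum_i v ord0 i * c i| <= d%:R * C * `|v|.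
Proof.
move=> cC; apply: le_trans (ler_norm_sum _ _ _) _.
apply: (@le_trans _ _ (\sum_(i < d) C * `|v|)).
  apply: ler_sum => i _; rewrite normrM mulrC.
  by apply: ler_pM => //; exact: coord_le_norm.
by rewrite sumr_const card_ord -[X in X <= _]mulr_natl mulrA.
Qed.

Lemma lipschitz_ball f x r C : (forall w, ball x r w -> differentiable f w) ->
  (forall w i, ball x r w -> `|dpartial i f w| <= C) ->
  forall y z, ball x r y -> ball x r z -> `|f z - f y| <= d%:R * C * `|z - y|.
Proof.
move=> df bf y z xy xz; have [t /andP[t0 t1] ->] := mvt_ball df xy xz.
by apply: sum_coord_le => i; apply: bf; exact: ball_segment.
Qed.

End mean_value.

Section partial_rules.
Context {R : realType} {d : nat}.
Implicit Types (x : 'rV[R]_d) (f g : 'rV[R]_d -> R).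

Lemma dpartialD i f g x : differentiable f x -> differentiable g x ->
  dpartial i (f + g) x = dpartial i f x + dpartial i g x.
Proof. by move=> df dg; apply: deriveD; exact: diff_derivable. Qed.

Lemma dpartialM i f g x : differentiable f x -> differentiable g x ->
  dpartial i (f * g) x = dpartial i f x * g x + f x * dpartial i g x.
Proof.
move=> df dg; rewrite /dpartial deriveM; try exact: diff_derivable.
by rewrite addrC /GRing.scale/=; congr (_ + _); rewrite mulrC.
Qed.

Lemma dpartial_cst i (c : R) x : dpartial i (cst c) x = 0.
Proof. exact: derive_cst. Qed.

Lemma dpartial_coord i j x : dpartial i (fun y => y ord0 j) x = (i == j)%:R.
Proof.
have -> : dpartial i (fun y : 'rV[R]_d => y ord0 j) x =
    ('D_(delta_mx ord0 i) id x : 'rV[R]_d) ord0 j.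
  by rewrite derive_mx ?mxE//; exact: derivable_id.
by rewrite derive_id mxE eqxx andTb eq_sym.
Qed.

End partial_rules.

Section row_functions.
Context {R : realType} {d e : nat}.
Implicit Types (x : 'rV[R]_d) (F : 'rV[R]_d -> 'rV[R]_e).

Lemma diff_row F x : (forall j, differentiable (fun y => F y ord0 j) x) ->
  differentiable F x.
Proof.
move=> h.
have -> : F = \sum_j (fun y => F y ord0 j *: (delta_mx ord0 j : 'rV[R]_e)).
  by apply/funext => y; rewrite fct_sumE {1}[F y]row_sum_delta.
by apply: differentiable_sum => j; exact: differentiableZl.
Qed.

Lemma jacobianE F x i j : (forall j, differentiable (fun y => F y ord0 j) x) ->
  jacobian F x i j = dpartial i (fun y => F y ord0 j) x.
Proof.
move=> h; have dF := diff_row h.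
rewrite /jacobian mxE -deriveE//.
by rewrite derive_mx ?mxE//; exact: diff_derivable.
Qed.

Lemma dpartial_comp i (f : 'rV[R]_e -> R) F x :
  (forall j, differentiable (fun y => F y ord0 j) x) ->
  differentiable f (F x) ->
  dpartial i (f \o F) x =
    \sum_j dpartial i (fun y => F y ord0 j) x * dpartial j f (F x).
Proof.
move=> h df; have dF := diff_row h.
rewrite /dpartial deriveE; last exact: differentiable_comp.
rewrite diff_comp//= -deriveE// derive_partials//; apply: eq_bigr => j _.
by rewrite -deriveE// derive_mx ?mxE//; exact: diff_derivable.
Qed.

End row_functions.

(** * Functions differentiable several times *)

Section Ck.
Context {R : realType}.

(** Every level asks for differentiability, so that [Ck k] means differentiable
    k + 1 times; in particular all partial derivatives of order at most k are
    continuous. *)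
Fixpoint Ck d (k : nat) (U : set 'rV[R]_d) (f : 'rV[R]_d -> R) : Prop :=
  (forall y, U y -> differentiable f y) /\
  (if k is k'.+1 then forall i, Ck k' U (dpartial i f) else True).

Lemma CkS d k (U : set 'rV[R]_d) f : Ck k.+1 U f <->
  (forall y, U y -> differentiable f y) /\ forall i, Ck k U (dpartial i f).
Proof. by []. Qed.

Lemma Ck_diff d k (U : set 'rV[R]_d) f y : Ck k U f -> U y -> differentiable f y.
Proof. by case: k => [|k] [h _]; exact: h. Qed.

Lemma Ck_partial d k (U : set 'rV[R]_d) f i : Ck k.+1 U f -> Ck k U (dpartial i f).
Proof. by move=> /CkS[_ h]. Qed.

Lemma Ck_sub d k (U V : set 'rV[R]_d) f : V `<=` U -> Ck k U f -> Ck k V f.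
Proof.
elim: k f => [|k IH] f VU; first by move=> [df _]; split => // y /VU; exact: df.
move=> /CkS[df hf]; apply/CkS; split => [y /VU|i]; first exact: df.
exact: IH.
Qed.

Lemma Ck_pred d k (U : set 'rV[R]_d) f : Ck k.+1 U f -> Ck k U f.
Proof.
elim: k f => [|k IH] f /CkS[df hf]; first by split.
by apply/CkS; split => // i; apply: IH.
Qed.

Lemma Ck_leq d k k' (U : set 'rV[R]_d) f : (k' <= k)%N -> Ck k U f -> Ck k' U f.
Proof.
move=> /subnK <-; elim: (k - k')%N => [//|m IH]; rewrite addSn => /Ck_pred.
exact: IH.
Qed.

Lemma Ck_ext d k (U : set 'rV[R]_d) f g : open U -> (forall y, U y -> f y = g y) ->
  Ck k U f -> Ck k U g.
Proof.
move=> oU; elim: k f g => [|k IH] f g fg.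
  move=> [df _]; split => // y Uy; apply: diff_near (df y Uy).
  by apply: filterS (open_nbhs_nbhs (conj oU Uy)).
move=> /CkS[df hf]; apply/CkS; split=> [y Uy|i].
  apply: diff_near (df y Uy).
  by apply: filterS (open_nbhs_nbhs (conj oU Uy)).
apply: (IH (dpartial i f)) => // y Uy; apply: dpartial_near.
by apply: filterS (open_nbhs_nbhs (conj oU Uy)).
Qed.

Lemma Ck_cst d k (U : set 'rV[R]_d) c : Ck k U (cst c).
Proof.
elim: k c => [|k IH] c; first by split.
apply/CkS; split => // i.
by rewrite (_ : dpartial i (cst c) = cst 0)//; apply/funext => y;
  exact: dpartial_cst.
Qed.

Lemma CkD d k (U : set 'rV[R]_d) f g : open U -> Ck k U f -> Ck k U g ->
  Ck k U (f + g).
Proof.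
move=> oU; elim: k f g => [|k IH] f g.
  move=> [df _] [dg _].
  by split => // y Uy; apply: differentiableD; [exact: df|exact: dg].
move=> /CkS[df hf] /CkS[dg hg]; apply/CkS.
split=> [y Uy|i]; first by apply: differentiableD; [exact: df|exact: dg].
apply: (Ck_ext oU _ (IH _ _ (hf i) (hg i))) => y Uy.
by rewrite dpartialD//; [exact: df|exact: dg].
Qed.

Lemma CkM d k (U : set 'rV[R]_d) f g : open U -> Ck k U f -> Ck k U g ->
  Ck k U (f * g).
Proof.
move=> oU; elim: k f g => [|k IH] f g.
  move=> [df hf] [dg hg].
  by split => // y Uy; apply: differentiableM; [exact: df|exact: dg].
move=> cf cg; have /CkS[df hf] := cf; have /CkS[dg hg] := cg.
apply/CkS; split=> [y Uy|i]; first by apply: differentiableM; [exact: df|exact: dg].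
have h : Ck k U (dpartial i f * g + f * dpartial i g).
  by apply: CkD => //; apply: IH => //; exact: Ck_pred.
apply: (Ck_ext oU _ h) => y Uy.
by rewrite dpartialM//; [exact: df|exact: dg].
Qed.

Lemma Ck_sum d k (U : set 'rV[R]_d) (I : Type) (r : seq I) (P : pred I)
    (F : I -> 'rV[R]_d -> R) : open U -> (forall i, P i -> Ck k U (F i)) ->
  Ck k U (fun y => \sum_(i <- r | P i) F i y).
Proof.
move=> oU h; rewrite -[X in Ck _ _ X]fct_sumE.
by elim/big_ind: _ => //; [exact: Ck_cst|by move=> *; exact: CkD].
Qed.

Lemma fct_prodE T (I : Type) (r : seq I) (P : pred I) (F : I -> T -> R) :
  (\prod_(i <- r | P i) F i) = (fun y => \prod_(i <- r | P i) F i y).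
Proof.
apply/funext => y; elim: r => [|a r IH]; first by rewrite !big_nil.
by rewrite !big_cons; case: ifP => _ //; rewrite -IH.
Qed.

Lemma Ck_prod d k (U : set 'rV[R]_d) (I : Type) (r : seq I) (P : pred I)
    (F : I -> 'rV[R]_d -> R) : open U -> (forall i, P i -> Ck k U (F i)) ->
  Ck k U (fun y => \prod_(i <- r | P i) F i y).
Proof.
move=> oU h; rewrite -[X in Ck _ _ X]fct_prodE.
by elim/big_ind: _ => //; [exact: Ck_cst|by move=> *; exact: CkM].
Qed.

(** Induction on k through the chain rule: each partial derivative of the
    composite is a sum of products of functions of class [Ck] of the previous
    level. *)
Lemma Ck_comp d e k (U : set 'rV[R]_d) (V : set 'rV[R]_e) f
    (F : 'rV[R]_d -> 'rV[R]_e) : open U -> (forall y, U y -> V (F y)) ->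
  (forall j, Ck k U (fun y => F y ord0 j)) -> Ck k V f -> Ck k U (f \o F).
Proof.
move=> oU UV; elim: k f => [|k IH] f hF hf.
  split => // y Uy; apply: differentiable_comp.
    by apply: diff_row => j; exact: Ck_diff (hF j) Uy.
  by apply: (Ck_diff hf); exact: UV.
apply/CkS; split=> [y Uy|i].
  apply: differentiable_comp.
    by apply: diff_row => j; exact: Ck_diff (hF j) Uy.
  by apply: (Ck_diff hf); exact: UV.
have h : Ck k U (fun y => \sum_j ((dpartial i (fun y => F y ord0 j)) *
    (dpartial j f \o F)) y).
  apply: Ck_sum => // j _; apply: CkM => //; first exact: Ck_partial.
  by apply: IH; [move=> j'; exact: Ck_pred|exact: Ck_partial].
apply: (Ck_ext oU _ h) => y Uy; rewrite dpartial_comp//.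
  by move=> j; exact: Ck_diff (hF j) Uy.
by apply: (Ck_diff hf); exact: UV.
Qed.

(** The head of the sequence is the innermost derivative. *)
Fixpoint pderiv d (s : seq 'I_d) (f : 'rV[R]_d -> R) : 'rV[R]_d -> R :=
  if s is i :: s' then pderiv s' (dpartial i f) else f.

Lemma pderiv_rcons d (s : seq 'I_d) i f :
  pderiv (rcons s i) f = dpartial i (pderiv s f).
Proof. by elim: s f => [|j s IH] f //=. Qed.

Lemma Ck_pderiv d k (U : set 'rV[R]_d) (s : seq 'I_d) f :
  Ck (size s + k) U f -> Ck k U (pderiv s f).
Proof. by elim: s f => [|i s IH] f // /CkS[_ h]; exact: IH. Qed.

End Ck.

Section locally_lipschitz.
Context {R : realType} {d : nat}.

Lemma continuous_near_le (f : 'rV[R]_d -> R) x : {for x, continuous f} ->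
  \forall y \near x, `|f y| <= 1 + `|f x|.
Proof.
move=> /cvgrPdist_lt/(_ 1 ltr01); apply: filterS => y; rewrite distrC => h1.
have := ler_normD (f y - f x) (f x).
by rewrite subrK => /le_trans; apply; rewrite lerD2r ltW.
Qed.

Lemma Ck1_lipschitz (f : 'rV[R]_d -> R) x r : 0 < r -> Ck 1 (ball x r) f ->
  exists C rho, [/\ 0 <= C, 0 < rho, rho <= r & forall y z, ball x rho y -> ball x rho z ->
    `|f z - f y| <= C * `|z - y|].
Proof.
move=> r0 /CkS[df cf].
have [rho rho0 h] : exists2 rho, 0 < rho & forall y, ball x rho y ->
    ball x r y /\ forall i, `|dpartial i f y| <= 1 + \sum_j `|dpartial j f x|.
  apply: cvg_rball; near=> y; split; first by near: y; exact: nbhsx_ballx.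
  near: y; apply: filter_forall => i.
  have ci : {for x, continuous (dpartial i f)}.
    by apply: differentiable_continuous; apply: (Ck_diff (cf i)); exact: ballxx.
  apply: filterS (continuous_near_le ci) => y /le_trans; apply.
  by rewrite lerD2l (bigD1 i)//= lerDl; apply: sumr_ge0.
exists (d%:R * (1 + \sum_j `|dpartial j f x|)), (Num.min rho r); split.
- by apply: mulr_ge0 => //; apply: addr_ge0 => //; apply: sumr_ge0.
- by rewrite lt_min rho0.
- by rewrite ge_min lexx orbT.
have mr : Num.min rho r <= rho by rewrite ge_min lexx.
apply: lipschitz_ball => w; first by move=> /(le_ball mr)/h[/df].
by move=> i /(le_ball mr)/h[].
Unshelve. all: by end_near. Qed.

End locally_lipschitz.

(** * Order of vanishing and iterated differences *)

Section flat.
Context {R : realType} {d : nat}.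
Implicit Types (x y z : 'rV[R]_d) (f g : 'rV[R]_d -> R) (s : seq 'I_d).

Lemma uniform_constant (I : finType) (T : Type) (F : set_system T) (FF : Filter F)
    (g : I -> T -> R) (h : T -> R) : (forall t, 0 <= h t) ->
  (forall i, exists C, \forall t \near F, g i t <= C * h t) ->
  exists2 C, 0 <= C & \forall t \near F, forall i, g i t <= C * h t.
Proof.
move=> h0 /choice[C hC]; exists (\sum_i `|C i|); first exact: sumr_ge0.
apply: filter_forall => i; apply: filterS (hC i) => t /le_trans; apply.
apply: ler_wpM2r => //; apply: le_trans (ler_norm _) _.
by rewrite (bigD1 i)//= lerDl; apply: sumr_ge0.
Qed.

(** The partial derivatives vanish to one order less; integrate their bound along
    segments from x with the mean value theorem. *)
Lemma flat_bound n f x r : 0 < r -> Ck n (ball x r) f ->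
  (forall s, (size s < n)%N -> pderiv s f x = 0) ->
  exists2 C, 0 <= C & \forall y \near x, `|f y| <= C * `|y - x| ^+ n.
Proof.
move=> r0; elim: n f => [|n IH] f cf fl.
  exists (1 + `|f x|); first exact: addr_ge0.
  have h : {for x, continuous f}.
    by apply: differentiable_continuous; apply: (Ck_diff cf); exact: ballxx.
  by apply: filterS (continuous_near_le h) => y; rewrite expr0 mulr1.
have /CkS[df hf] := cf.
have [C C0 hC] : exists2 C, 0 <= C & \forall y \near x, forall i,
    `|dpartial i f y| <= C * `|y - x| ^+ n.
  apply: (@uniform_constant _ _ (nbhs x) _ (fun i y => `|dpartial i f y|)
    (fun y => `|y - x| ^+ n)) => [y|i]; first exact: exprn_ge0.
  have [s sn|C _ hC] := IH (dpartial i f) (hf i); last by exists C.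
  by have := fl (i :: s); apply.
have [rho rho0 h] := cvg_rball hC.
exists (d%:R * C); first exact: mulr_ge0.
near=> y.
have yr : ball x r y by near: y; exact: nbhsx_ballx.
have yrho : ball x rho y by near: y; exact: nbhsx_ballx.
have fx : f x = 0 by exact: (fl [::]).
have [t /andP[t0 t1]] := mvt_ball df (ballxx x r0) yr.
rewrite fx subr0 => ->; rewrite exprSr mulrA -(mulrA d%:R).
apply: sum_coord_le => i; apply: le_trans.
  by apply: h; apply: ball_segment => //; exact: ballxx.
apply: ler_wpM2l => //; apply: lerXn2r; rewrite ?nnegrE//.
by rewrite addrC addKr normrZ (ger0_norm t0) ler_piMl.
Unshelve. all: by end_near. Qed.

Fixpoint fdiff (t : R) s f : 'rV[R]_d -> R :=
  if s is i :: s' then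
    fun y => fdiff t s' f (y + t *: delta_mx ord0 i) - fdiff t s' f y
  else f.

Lemma fdiff_rcons t s i f y : fdiff t (rcons s i) f y = fdiff t (i :: s) f y.
Proof.
elim: s y => [|j s IH] y //=; rewrite !IH /= addrAC [y + _ + _]addrAC.
ring.
Qed.

Lemma norm_delta (i : 'I_d) : `|delta_mx ord0 i : 'rV[R]_d| <= 1.
Proof.
by apply: norm_le_coord => // j; rewrite mxE eqxx; case: eqP => _;
  rewrite ?normr1 ?normr0.
Qed.

Lemma dpartial_shift i f a y :
  dpartial i (fun z => f (z + a)) y = dpartial i f (y + a).
Proof.
rewrite /dpartial /derive /=.
rewrite (_ : (fun h : R => _) = (fun h => h^-1 *:
  ((f \o shift (y + a)) (h *: delta_mx ord0 i) - f (y + a))))//.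
by apply/funext => h /=; rewrite addrA.
Qed.

Lemma diff_shift f a y : differentiable f (y + a) ->
  differentiable (fun z => f (z + a)) y.
Proof.
by move=> df; apply: (@differentiable_comp _ _ _ _ (fun z => z + a) f).
Qed.

Lemma step_norm (t : R) i y z rho : 0 <= t -> `|z - y| <= rho ->
  `|z - (y + t *: delta_mx ord0 i)| <= rho + t.
Proof.
move=> t0 h; rewrite opprD addrA; apply: le_trans (ler_normB _ _) _.
apply: lerD => //; rewrite normrZ (ger0_norm t0) -[leRHS]mulr1.
by apply: ler_wpM2l => //; exact: norm_delta.
Qed.

Lemma step_norm' (t : R) i y z rho : 0 <= t ->
  `|z - (y + t *: delta_mx ord0 i)| <= rho -> `|z - y| <= rho + t.
Proof.
move=> t0 h; rewrite -(subrK (y + t *: delta_mx ord0 i) z) -addrA.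
apply: le_trans (ler_normD _ _) _; apply: lerD => //.
rewrite addrAC subrr add0r normrZ (ger0_norm t0) -[leRHS]mulr1.
by apply: ler_wpM2l => //; exact: norm_delta.
Qed.

Lemma dpartial_fdiff t s i f y : 0 <= t ->
  (forall z, `|z - y| <= (size s)%:R * t -> differentiable f z) ->
  differentiable (fdiff t s f) y /\
  dpartial i (fdiff t s f) y = fdiff t s (dpartial i f) y.
Proof.
move=> t0; elim: s y => [|j s IH] y h /=.
  by split => //; apply: h; rewrite subrr normr0 mul0r.
have [|d1 e1] := IH y.
  move=> z hz; apply: h; apply: le_trans hz _; apply: ler_wpM2r => //.
  by rewrite ler_nat.
have [|d2 e2] := IH (y + t *: delta_mx ord0 j).
  move=> z /(step_norm' t0) hz; apply: h; apply: le_trans hz _.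
  by rewrite -[X in _ + X <= _]mul1r -mulrDl /= -natr1.
have d3 : differentiable (fun z => fdiff t s f (z + t *: delta_mx ord0 j)) y.
  exact: diff_shift.
split; first exact: differentiableB.
rewrite -e1 -e2 -dpartial_shift.
by rewrite /dpartial deriveB//; exact: diff_derivable.
Qed.

(** One mean value theorem per step: a difference in the direction i of an
    iterated difference of f is t times the iterated difference of the partial
    derivative at an intermediate point. *)
Lemma fdiff_mvt t s f x y r : 0 < t -> Ck (size s) (ball x r) f ->
  `|y - x| + (size s)%:R * t < r ->
  exists2 xi, `|xi - y| <= (size s)%:R * t &
    fdiff t s f y = t ^+ size s * pderiv s f xi.
Proof.
move=> t0; elim: s f y => [|i s IH] f y cf h /=.
  by exists y; rewrite ?subrr ?normr0 ?mul0r// expr0 mul1r.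
have {}t0' := ltW t0.
have /CkS[df hf] := cf.
pose y' := y + t *: delta_mx ord0 i.
have yt : y' - y = t *: delta_mx ord0 i by rewrite /y' addrC addKr.
pose rho := r - `|y - x| - (size s)%:R * t.
have trho : t < rho.
  by rewrite /rho ltrBrDr ltrBrDr addrC -[X in _ + (X + _)]mul1r -mulrDl nat1r.
have dg w : ball y rho w -> differentiable (fdiff t s f) w /\
    dpartial i (fdiff t s f) w = fdiff t s (dpartial i f) w.
  move=> /rball_normE yw; apply: dpartial_fdiff => // z hz; apply: df.
  apply/rball_normE; have -> : z - x = (z - w) + (w - y) + (y - x).
    by rewrite !addrA !subrK.
  apply: le_lt_trans (ler_normD _ _) _; rewrite -ltrBrDr.
  apply: le_lt_trans (ler_normD _ _) _.
  by rewrite addrC -ltrBrDr; apply: lt_le_trans yw _; rewrite /rho lerD2l lerN2.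
have rho0 : 0 < rho by exact: lt_trans trho.
have nd : `|y' - y| <= t.
  rewrite yt normrZ (ger0_norm t0') -[leRHS]mulr1.
  by apply: ler_wpM2l => //; exact: norm_delta.
have yy' : ball y rho y' by apply/rball_normE; exact: le_lt_trans trho.
have [th /andP[th0 th1]] := mvt_ball (fun w hw => (dg w hw).1) (ballxx y rho0) yy'.
set w := y + th *: (y' - y) => ->.
have wy : `|w - y| <= t.
  by rewrite /w addrC addKr normrZ (ger0_norm th0); apply: le_trans nd;
    rewrite ler_piMl.
have bw : ball y rho w by apply/rball_normE; exact: le_lt_trans trho.
rewrite (bigD1 i)//= big1 ?addr0; last first.
  by move=> j ji; rewrite yt !mxE eqxx (negbTE ji) mulr0 mul0r.
rewrite (dg w bw).2 yt !mxE !eqxx mulr1.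
have [|xi hxi ->] := IH (dpartial i f) w (hf i).
  apply: le_lt_trans h; rewrite /= -[in leRHS]natr1 mulrDl mul1r addrA addrAC lerD2r.
  apply: le_trans (ler_distD y w x) _; rewrite [leRHS]addrC lerD2r.
exact: wy.
exists xi; last by rewrite exprS mulrA.
rewrite -(subrK w xi) -addrA; apply: le_trans (ler_normD _ _) _.
by rewrite -natr1 mulrDl mul1r; exact: lerD.
Qed.

Lemma fdiff_bound t s f y B : 0 <= t ->
  (forall z, `|z - y| <= (size s)%:R * t -> `|f z| <= B) ->
  `|fdiff t s f y| <= 2 ^+ size s * B.
Proof.
move=> t0; elim: s y => [|i s IH] y h /=.
  by rewrite expr0 mul1r; apply: h; rewrite subrr normr0 mul0r.
rewrite exprS -mulrA mulrDl mul1r; apply: le_trans (ler_normB _ _) _.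
apply: lerD; apply: IH => z hz; apply: h.
  have := step_norm' t0 hz => /le_trans; apply.
  by rewrite -[X in _ + X <= _]mul1r -mulrDl /= -natr1.
by apply: le_trans hz _; apply: ler_wpM2r => //; rewrite ler_nat.
Qed.

Lemma fdiff_limit s f x r : 0 < r -> Ck (size s) (ball x r) f ->
  forall eps, 0 < eps -> exists2 t0, 0 < t0 & forall t, 0 < t -> t < t0 ->
    `|fdiff t s f x - t ^+ size s * pderiv s f x| <= eps * t ^+ size s.
Proof.
move=> r0 cf eps e0.
have c : {for x, continuous (pderiv s f)}.
  apply: differentiable_continuous; apply: (@Ck_diff _ _ 0 (ball x r)).
    by apply: Ck_pderiv; rewrite addn0.
  exact: ballxx.
have [rho rho0 hrho] : exists2 rho, 0 < rho & forall y, ball x rho y ->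
    `|pderiv s f x - pderiv s f y| < eps.
  by apply: cvg_rball; have /cvgrPdist_lt := c; apply.
pose m := Num.min r rho; have m0 : 0 < m by rewrite lt_min r0.
exists (m / (size s).+1%:R); first by rewrite divr_gt0.
move=> t t0; rewrite ltr_pdivlMr// => tm.
have st : (size s)%:R * t < m.
  by apply: le_lt_trans tm; rewrite mulrC ler_wpM2l ?ler_nat// ltW.
have [|xi hxi ->] := @fdiff_mvt t s f x x r t0 cf.
  by rewrite subrr normr0 add0r; apply: lt_le_trans st _; rewrite ge_min lexx.
rewrite -mulrBr normrM mulrC normrX (gtr0_norm t0) distrC.
apply: ler_wpM2r; first by rewrite exprn_ge0// ltW.
apply/ltW/hrho/rball_normE; apply: le_lt_trans hxi _.
by apply: lt_le_trans st _; rewrite ge_min lexx orbT.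
Qed.

Lemma le0_eps (a : R) : (forall eps, 0 < eps -> a <= eps) -> a <= 0.
Proof. by move=> h; apply/ler_addgt0Pr => e e0; rewrite add0r; exact: h. Qed.

(** Symmetry of partial derivatives: both sides are limits of the same iterated
    difference quotients, since the difference operators commute. *)
Lemma pderiv_rotate s i f x r : 0 < r -> Ck (size s).+1 (ball x r) f ->
  pderiv (rcons s i) f x = pderiv (i :: s) f x.
Proof.
move=> r0 cf; apply/eqP; rewrite -subr_eq0 -normr_le0; apply: le0_eps => eps e0.
have e20 : 0 < eps / 2 by rewrite divr_gt0.
have cf' : Ck (size (rcons s i)) (ball x r) f by rewrite size_rcons.
have [t1 t10 h1] := fdiff_limit r0 cf' e20.
have [t2 t20 h2] := @fdiff_limit (i :: s) f x r r0 cf _ e20.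
pose t := Num.min t1 t2 / 2.
have m0 : 0 < Num.min t1 t2 by rewrite lt_min t10.
have t0 : 0 < t by rewrite divr_gt0.
have tm : t < Num.min t1 t2 by rewrite /t ltr_pdivrMr// ltr_pMr// ltr1n.
have tt1 : t < t1 by apply: lt_le_trans tm _; rewrite ge_min lexx.
have tt2 : t < t2 by apply: lt_le_trans tm _; rewrite ge_min lexx orbT.
move: (h1 t t0 tt1) (h2 t t0 tt2); rewrite fdiff_rcons size_rcons.
set D := fdiff _ _ _ _; move=> a1 a2.
have tk : 0 < t ^+ (size s).+1 by rewrite exprn_gt0.
suff H : `|(pderiv (rcons s i) f x - pderiv (i :: s) f x) * t ^+ (size s).+1| <=
    eps * t ^+ (size s).+1.
  by move: H; rewrite normrM (gtr0_norm tk) ler_pM2r.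
have -> : (pderiv (rcons s i) f x - pderiv (i :: s) f x) * t ^+ (size s).+1 =
  (D - t ^+ (size (i :: s)) * pderiv (i :: s) f x) -
  (D - t ^+ (size s).+1 * pderiv (rcons s i) f x) by rewrite /=; ring.
rewrite [eps]splitr mulrDl.
by apply: le_trans (ler_normB _ _) _; exact: lerD.
Qed.

(** Converse of [flat_bound]. For |s| = k < n, the iterated difference of step t at
    x is O(t^n), whereas it is t^k times the derivative up to o(t^k). *)
Lemma flat_of_bound n s f x r C : 0 < r -> 0 <= C -> (size s < n)%N ->
  Ck (size s) (ball x r) f ->
  (\forall y \near x, `|f y| <= C * `|y - x| ^+ n) -> pderiv s f x = 0.
Proof.
move=> r0 C0 sn cf hC; have [rho rho0 h] := cvg_rball hC.
apply/eqP; rewrite -normr_le0; apply: le0_eps => eps e0.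
have e20 : 0 < eps / 2 by rewrite divr_gt0.
have [t1 t10 h1] := fdiff_limit r0 cf e20.
set k := size s in sn h1 *.
pose B := 2 ^+ k * (C * k%:R ^+ n).
have B0 : 0 <= B by rewrite !mulr_ge0// exprn_ge0.
(* The factor 1 / (k + 1) keeps the points of the difference in the ball where
   the bound holds, and the last term makes B * t less than eps / 2. *)
pose t := Num.min (Num.min t1 1) (Num.min (rho / k.+1%:R) (eps / 2 / (B + 1))) / 2.
set m := Num.min _ _ in t.
have m0 : 0 < m.
  by rewrite !lt_min t10 ltr01 !divr_gt0//; apply: ltr_wpDl.
have t0 : 0 < t by rewrite divr_gt0.
have tm : t < m by rewrite /t ltr_pdivrMr// ltr_pMr// ltr1n.
have /andP[/andP[tt1 tle1] /andP[trho teps]] :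
    (t < t1) && (t < 1) && ((t < rho / k.+1%:R) && (t < eps / 2 / (B + 1))).
  by move: tm; rewrite /m !lt_min.
clearbody t.
have hb : `|fdiff t s f x| <= B * t ^+ n.
  have -> : B * t ^+ n = 2 ^+ k * (C * (k%:R * t) ^+ n).
    by rewrite [in RHS]exprMn /B !mulrA.
  apply: fdiff_bound => [|z hz]; first exact: ltW.
  apply: le_trans (h z _) _.
    apply/rball_normE; apply: le_lt_trans hz _.
    move: trho; rewrite ltr_pdivlMr//; apply: le_lt_trans.
    by rewrite mulrC ler_wpM2l ?ler_nat// ltW.
  by apply: ler_wpM2l => //; apply: lerXn2r; rewrite ?nnegrE// mulr_ge0// ltW.
have tk0 : 0 < t ^+ k by rewrite exprn_gt0.
rewrite -(ler_pM2l tk0) -{1}(ger0_norm (ltW tk0)) -normrM.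
have -> : t ^+ k * pderiv s f x = fdiff t s f x -
  (fdiff t s f x - t ^+ k * pderiv s f x) by ring.
apply: le_trans (ler_normB _ _) _; rewrite [eps]splitr mulrDr.
have h1t := h1 t t0 tt1; rewrite [leRHS]mulrC in h1t.
apply: lerD; last exact: h1t.
apply: le_trans hb _.
have -> : t ^+ n = t ^+ k * t * t ^+ (n - k.+1).
  by rewrite -exprSr -exprD subnKC.
have tp1 : t ^+ (n - k.+1) <= 1 by apply: exprn_ile1 => //; exact: ltW.
rewrite [leLHS](_ : _ = t ^+ k * (t * (t ^+ (n - k.+1) * B))); last by ring.
apply: ler_wpM2l; first exact: ltW.
apply: (@le_trans _ _ (t * (B + 1))); last first.
  by move: teps; rewrite ltr_pdivlMr; [exact: ltW|exact: ltr_wpDl].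
apply: ler_wpM2l; first exact: ltW.
apply: (@le_trans _ _ (1 * B)); first exact: ler_wpM2r.
by rewrite mul1r lerDl.
Qed.

End flat.

(** * Real analytic functions through bounds on their derivatives *)

Section dbound.
Context {R : realType} {d : nat}.
Implicit Types (x y z : 'rV[R]_d) (U V : set 'rV[R]_d) (f g : 'rV[R]_d -> R)
  (b : nat -> R).

(** [b n] bounds all the partial derivatives of order n, for n up to k. *)
Fixpoint dbound (k : nat) U b f : Prop :=
  (forall y, U y -> differentiable f y /\ `|f y| <= b 0%N) /\
  (if k is k'.+1 then forall i, dbound k' U (fun n => b n.+1) (dpartial i f)
   else True).

Lemma dboundS k U b f : dbound k.+1 U b f <->
  (forall y, U y -> differentiable f y /\ `|f y| <= b 0%N) /\
  forall i, dbound k U (fun n => b n.+1) (dpartial i f).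
Proof. by []. Qed.

Lemma dbound0 k U b f y : dbound k U b f -> U y ->
  differentiable f y /\ `|f y| <= b 0%N.
Proof. by case: k => [|k] [h _]; exact: h. Qed.

Lemma dbound_Ck k U b f : dbound k U b f -> Ck k U f.
Proof.
elim: k b f => [|k IH] b f.
  by move=> [h _]; split => // y /h[].
move=> /dboundS[h hf]; apply/CkS; split => [y /h[]//|i].
exact: IH (hf i).
Qed.

Lemma dbound_pred k U b f : dbound k.+1 U b f -> dbound k U b f.
Proof.
elim: k b f => [|k IH] b f /dboundS[h hf]; first by split.
by apply/dboundS; split => // i; exact: IH (hf i).
Qed.

Lemma dbound_mono k U V b b' f : V `<=` U -> (forall n, b n <= b' n) ->
  dbound k U b f -> dbound k V b' f.
Proof.
move=> VU; elim: k b b' f => [|k IH] b b' f bb'.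
  by move=> [h _]; split => // y /VU/h[? hb]; split => //; exact: le_trans (bb' 0%N).
move=> /dboundS[h hf]; apply/dboundS; split => [y /VU/h[? hb]|i].
  by split => //; exact: le_trans (bb' 0%N).
by apply: IH (hf i) => n.
Qed.

Lemma dbound_ext k U b f g : open U -> (forall y, U y -> f y = g y) ->
  dbound k U b f -> dbound k U b g.
Proof.
move=> oU; have near y : U y -> nbhs y U by move=> Uy; exact: open_nbhs_nbhs.
have h0 b' f' g' : (forall y, U y -> f' y = g' y) ->
    (forall y, U y -> differentiable f' y /\ `|f' y| <= b' 0%N) ->
    (forall y, U y -> differentiable g' y /\ `|g' y| <= b' 0%N).
  move=> fg h y Uy; have [df bf] := h y Uy; rewrite -fg//; split => //.
  by apply: diff_near df; apply: filterS (near y Uy).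
elim: k b f g => [|k IH] b f g fg.
  by move=> [h _]; split => //; exact: (h0 b f).
move=> /dboundS[h hf]; apply/dboundS; split; first exact: (h0 b f).
move=> i; apply: IH (hf i) => y Uy; apply: dpartial_near.
by apply: filterS (near y Uy).
Qed.

Lemma dboundD k U b b' f g : open U -> dbound k U b f -> dbound k U b' g ->
  dbound k U (fun n => b n + b' n) (f + g).
Proof.
move=> oU; have h0 c c' f' g' :
    (forall y, U y -> differentiable f' y /\ `|f' y| <= c 0%N) ->
    (forall y, U y -> differentiable g' y /\ `|g' y| <= c' 0%N) ->
    forall y, U y -> differentiable (f' + g') y /\
      `|(f' + g') y| <= c 0%N + c' 0%N.
  move=> hf hg y Uy; have [df bf] := hf y Uy; have [dg bg] := hg y Uy.
  split; first exact: differentiableD.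
  by apply: le_trans (ler_normD _ _) _; exact: lerD.
elim: k b b' f g => [|k IH] b b' f g.
  by move=> [hf _] [hg _]; split => //; exact: (h0 b b').
move=> /dboundS[hf hf'] /dboundS[hg hg']; apply/dboundS.
split; first exact: (h0 b b').
move=> i; apply: (dbound_ext oU _ (IH _ _ _ _ (hf' i) (hg' i))) => y Uy.
by rewrite dpartialD//; [exact: (hf y Uy).1|exact: (hg y Uy).1].
Qed.

Lemma dbound_cst k U (c : R) b : `|c| <= b 0%N -> (forall n, 0 <= b n) ->
  dbound k U b (cst c).
Proof.
elim: k c b => [|k IH] c b cb b0; first by split => // y _; split => //; exact: differentiable_cst.
apply/dboundS; split => [y _|i]; first by split => //; exact: differentiable_cst.
rewrite (_ : dpartial i (cst c) = cst 0).
  by apply: IH => //; rewrite normr0.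
by apply/funext => y; exact: dpartial_cst.
Qed.

Lemma dboundZ k U b f (c : R) : open U -> dbound k U b f ->
  dbound k U (fun n => `|c| * b n) (fun y => c * f y).
Proof.
move=> oU; elim: k b f => [|k IH] b f.
  move=> [h _]; split => // y /h[df bf]; split.
    by apply: differentiableZ.
  by rewrite normrM; apply: ler_wpM2l.
move=> /dboundS[h hf]; apply/dboundS; split => [y /h[df bf]|i].
  split; first by apply: differentiableZ.
  by rewrite normrM; apply: ler_wpM2l.
apply: (dbound_ext oU _ (IH _ _ (hf i))) => y Uy.
have := @deriveZ R _ _ f c y (delta_mx ord0 i) (diff_derivable (h y Uy).1).
by rewrite /dpartial => ->.
Qed.

Lemma fact_mul_leq a c : (a`! * c`! <= (a + c)`!)%N.
Proof.
rewrite -(@bin_fact (a + c) a) ?leq_addr// addnC addnK.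
by rewrite leq_pmull// bin_gt0 leq_addl.
Qed.

(** The derivatives of f * g are products of a derivative of f and one of g; the
    shifts a and c record how often each factor was already differentiated, and
    a! c! <= (a + c)! makes the induction go through. Each derivative doubles the
    number of terms, whence the factor 2^n. *)
Lemma dboundM k U f g (C C' K : R) a c : 0 <= C -> 0 <= C' -> 0 <= K -> open U ->
  dbound k U (fun n => C * K ^+ (n + a) * (n + a)`!%:R) f ->
  dbound k U (fun n => C' * K ^+ (n + c) * (n + c)`!%:R) g ->
  dbound k U (fun n => C * C' * 2 ^+ n * K ^+ (n + a + c) * (n + a + c)`!%:R)
    (f * g).
Proof.
move=> C0 C'0 K0 oU.
have h0 f' g' a' c' :
    (forall y, U y -> differentiable f' y /\ `|f' y| <= C * K ^+ a' * a'`!%:R) ->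
    (forall y, U y -> differentiable g' y /\ `|g' y| <= C' * K ^+ c' * c'`!%:R) ->
    forall y, U y -> differentiable (f' * g') y /\
      `|(f' * g') y| <= C * C' * 2 ^+ 0 * K ^+ (a' + c') * (a' + c')`!%:R.
  move=> hf hg y Uy; have [df bf] := hf y Uy; have [dg bg] := hg y Uy.
  split; first exact: differentiableM.
  rewrite normrM; apply: le_trans (ler_pM (normr_ge0 _) (normr_ge0 _) bf bg) _.
  rewrite expr0 mulr1 exprD.
  rewrite [leLHS](_ : _ = C * C' * (K ^+ a' * K ^+ c') * (a'`! * c'`!)%:R); last first.
    by rewrite natrM; ring.
  by rewrite ler_wpM2l ?mulr_ge0 ?exprn_ge0// ler_nat fact_mul_leq.
elim: k f g a c => [|k IH] f g a c.
  by move=> [hf _] [hg _]; split => //; exact: h0.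
move=> hf hg; have /dboundS[df hf'] := hf; have /dboundS[dg hg'] := hg.
apply/dboundS; split; first exact: h0.
move=> i.
have H1 : dbound k U (fun n => C * C' * 2 ^+ n * K ^+ (n + a.+1 + c) *
    (n + a.+1 + c)`!%:R) (dpartial i f * g).
  apply: IH; last exact: dbound_pred.
  by apply: dbound_mono (hf' i) => // n; rewrite addSnnS.
have H2 : dbound k U (fun n => C * C' * 2 ^+ n * K ^+ (n + a + c.+1) *
    (n + a + c.+1)`!%:R) (f * dpartial i g).
  apply: IH; first exact: dbound_pred.
  by apply: dbound_mono (hg' i) => // n; rewrite addSnnS.
have H := dboundD oU H1 H2.
apply: (dbound_ext oU) (dbound_mono (@subset_refl _ _) _ H) => [y Uy|n].
  by rewrite dpartialM//; [exact: (df y Uy).1|exact: (dg y Uy).1].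
rewrite !addSn !addnS !addSn [2 ^+ n.+1]exprS.
set F := _`!%:R; set P := K ^+ _.
by rewrite le_eqVlt; apply/orP; left; apply/eqP; ring.
Qed.

(** The Cauchy estimates of a real analytic function, uniformly on U. *)
Definition analytic_bounded U f := exists C K : R, [/\ 0 <= C, 0 <= K &
  forall k, dbound k U (fun n => C * K ^+ n * n`!%:R) f].

Lemma ab_sub U V f : V `<=` U -> analytic_bounded U f -> analytic_bounded V f.
Proof.
move=> VU [C [K [C0 K0 h]]]; exists C, K; split => // k.
exact: dbound_mono (h k).
Qed.

Lemma ab_Ck U f k : analytic_bounded U f -> Ck k U f.
Proof. by move=> [C [K [_ _ /(_ k)/dbound_Ck]]]. Qed.

Lemma ab_cst U (c : R) : analytic_bounded U (cst c).
Proof.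
exists `|c|, 1; split => // k; apply: dbound_cst => [|n].
  by rewrite expr0 !mulr1.
by rewrite !mulr_ge0// exprn_ge0.
Qed.

Lemma ab_raise U f (C K C' K' : R) : 0 <= C -> 0 <= K -> C <= C' -> K <= K' ->
  (forall k, dbound k U (fun n => C * K ^+ n * n`!%:R) f) ->
  (forall k, dbound k U (fun n => C' * K' ^+ n * n`!%:R) f).
Proof.
move=> C0 K0 CC' KK' h k; apply: dbound_mono (h k) => // n.
apply: ler_wpM2r => //; apply: ler_pM => //; first exact: exprn_ge0.
by apply: lerXn2r => //; rewrite nnegrE //; exact: le_trans KK'.
Qed.

Lemma abD U f g : open U -> analytic_bounded U f -> analytic_bounded U g ->
  analytic_bounded U (f + g).
Proof.
move=> oU [C [K [C0 K0 h]]] [C' [K' [C'0 K'0 h']]].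
exists (C + C'), (Num.max K K'); split; [exact: addr_ge0|by rewrite le_max K0|].
move=> k.
have H := @ab_raise U f C K C (Num.max K K') C0 K0 (lexx _) _ h k.
have H' := @ab_raise U g C' K' C' (Num.max K K') C'0 K'0 (lexx _) _ h' k.
apply: dbound_mono (dboundD oU (H _) (H' _)) => [//|n||].
- by rewrite -!mulrDl.
- by rewrite le_max lexx.
- by rewrite le_max lexx orbT.
Qed.

Lemma abM U f g : open U -> analytic_bounded U f -> analytic_bounded U g ->
  analytic_bounded U (f * g).
Proof.
move=> oU [C [K [C0 K0 h]]] [C' [K' [C'0 K'0 h']]].
have m0 : 0 <= Num.max K K' by rewrite le_max K0.
exists (C * C'), (2 * Num.max K K'); split; [exact: mulr_ge0|exact: mulr_ge0|].
move=> k.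
have KK : K <= Num.max K K' by rewrite le_max lexx.
have K'K : K' <= Num.max K K' by rewrite le_max lexx orbT.
have H := @ab_raise U f C K C (Num.max K K') C0 K0 (lexx _) KK h k.
have H' := @ab_raise U g C' K' C' (Num.max K K') C'0 K'0 (lexx _) K'K h' k.
have := @dboundM k U f g C C' (Num.max K K') 0 0 C0 C'0 m0 oU.
have e c : (fun n => c * Num.max K K' ^+ (n + 0) * (n + 0)`!%:R) =
    (fun n => c * Num.max K K' ^+ n * n`!%:R).
  by apply/funext => n; rewrite addn0.
rewrite !e => /(_ H H'); apply: dbound_mono => // n.
by rewrite !addn0 exprMn !mulrA.
Qed.

(** The extra factor n + 1 of (n + 1)! is absorbed in a factor 2^n. *)
Lemma ab_partial U f i : analytic_bounded U f -> analytic_bounded U (dpartial i f).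
Proof.
move=> [C [K [C0 K0 h]]]; exists (C * K), (2 * K); split; try exact: mulr_ge0.
move=> k; have /dboundS[_ /(_ i)] := h k.+1; apply: dbound_mono => // n.
rewrite factS natrM exprMn exprS.
rewrite [leLHS](_ : _ = n.+1%:R * (C * K * K ^+ n * n`!%:R)); last by ring.
rewrite [leRHS](_ : _ = 2 ^+ n * (C * K * K ^+ n * n`!%:R)); last by ring.
apply: ler_wpM2r; first by rewrite !mulr_ge0// exprn_ge0.
by rewrite -natrX ler_nat ltn_expl.
Qed.

Lemma ab_sum U (I : Type) (r : seq I) (P : pred I)
    (F : I -> 'rV[R]_d -> R) : open U -> (forall i, P i -> analytic_bounded U (F i)) ->
  analytic_bounded U (fun y => \sum_(i <- r | P i) F i y).
Proof.
move=> oU h; rewrite -[X in analytic_bounded _ X]fct_sumE.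
by elim/big_ind: _ => //; [exact: ab_cst|by move=> *; exact: abD].
Qed.

Lemma ab_prod U (I : Type) (r : seq I) (P : pred I)
    (F : I -> 'rV[R]_d -> R) : open U -> (forall i, P i -> analytic_bounded U (F i)) ->
  analytic_bounded U (fun y => \prod_(i <- r | P i) F i y).
Proof.
move=> oU h; rewrite -[X in analytic_bounded _ X]fct_prodE.
by elim/big_ind: _ => //; [exact: ab_cst|by move=> *; exact: abM].
Qed.

Lemma ab_det U e (A : 'rV[R]_d -> 'M[R]_e) : open U ->
  (forall i j, analytic_bounded U (fun y => A y i j)) ->
  analytic_bounded U (fun y => \det (A y)).
Proof.
move=> oU h; rewrite /determinant; apply: ab_sum => // s _.
apply: abM => //; first exact: ab_cst.
by apply: ab_prod.
Qed.

(** The remainder of the Taylor formula of order n, when the Taylor polynomial is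
    zero. On the segment t |-> x + t (y - x), the derivative is bounded by
    A t^n / n! by induction, so A t^(n+1) / (n+1)! - f is nondecreasing. *)
Lemma flat_taylor n x r b f : 0 < r -> (forall n, 0 <= b n) ->
  dbound n (ball x r) b f ->
  (forall s, (size s < n)%N -> pderiv s f x = 0) ->
  forall y, ball x r y -> `|f y| <= b n * (d%:R * `|y - x|) ^+ n / n`!%:R.
Proof.
move=> r0; elim: n b f => [|n IH] b f b0 hb fl y xy.
  by rewrite expr0 fact0 divr1 mulr1; have [] := dbound0 hb xy.
have /dboundS[h hf] := hb.
pose v := y - x; pose A := b n.+1 * (d%:R * `|v|) ^+ n.+1.
pose p : {poly R} := (A / n.+1`!%:R) *: 'X^(n.+1).
pose phi (t : R) := f (x + t *: v).
pose phi' (t : R) := \sum_i v ord0 i * dpartial i f (x + t *: v).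
have inb t : 0 <= t -> t <= 1 -> ball x r (x + t *: v).
  by move=> t0 t1; apply: ball_segment => //; exact: ballxx.
have dphi (t : R) : 0 <= t -> t <= 1 -> is_derive t 1 phi (phi' t).
  by move=> t0 t1; apply: is_derive_line; exact: (h _ (inb t t0 t1)).1.
have bphi (t : R) : 0 <= t -> t <= 1 -> `|phi' t| <= A * t ^+ n / n`!%:R.
  move=> t0 t1.
  have C i : `|dpartial i f (x + t *: v)| <=
      b n.+1 * (d%:R * (t * `|v|)) ^+ n / n`!%:R.
    apply: le_trans (IH _ _ _ (hf i) _ _ (inb t t0 t1)) _ => [m|s sn|].
    - exact: b0.
    - by have := fl (i :: s); apply.
    - by rewrite addrC addKr normrZ (ger0_norm t0).
  apply: le_trans (sum_coord_le v C) _.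
  rewrite le_eqVlt; apply/orP; left; apply/eqP.
  by rewrite /A exprS !exprMn; ring.
have dp (t : R) : is_derive t 1 (horner p) (A * t ^+ n / n`!%:R).
  apply: (is_derive_eq (is_derive_poly p t)).
  rewrite /p derivZ derivXn hornerZ hornerMn hornerXn factS natrM invfM.
  rewrite -mulr_natl /=.
  have n1 : n.+1%:R != 0 :> R by rewrite pnatr_eq0.
  have f1 : n`!%:R != 0 :> R by rewrite pnatr_eq0 -lt0n fact_gt0.
  rewrite -[t ^+ n *+ n.+1]mulr_natr mulr1.
  move: (n.+1%:R : R) (n`!%:R : R) (t ^+ n) n1 f1 => N F T n1 f1.
  by field; rewrite n1 f1.
have key (e : R) : `|e| = 1 -> e * f y <= A / n.+1`!%:R.
  move=> e1.
  pose H := horner p - e \*: phi.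
  have dH (t : R) : 0 <= t -> t <= 1 ->
      is_derive t 1 H (A * t ^+ n / n`!%:R - e *: phi' t).
    by move=> t0 t1; have := dphi t t0 t1 => ?; exact: is_deriveB.
  have [|/=|c] := @MVT_segment R H (fun t => A * t ^+ n / n`!%:R - e *: phi' t) 0 1 ler01.
  - by move=> t; rewrite in_itv/= => /andP[t0 t1]; apply: dH; exact: ltW.
  - apply: derivable_within_continuous => t; rewrite in_itv/= => /andP[t0 t1].
    exact: (@ex_derive _ _ _ _ _ _ _ (dH t t0 t1)).
  rewrite in_itv/= => /andP[c0 c1].
  have -> : H 1 - H 0 = A / n.+1`!%:R - e * f y.
    rewrite /H /phi -![(horner p - e \*: _) _]/(p.[_] - e * f _) /p.
    rewrite !hornerZ !hornerXn expr1n expr0n/= scale0r addr0 scale1r mulr0 sub0r.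
    rewrite mulr1 /v [x + (y - x)]addrC subrK.
    by have := fl [::] isT; rewrite /= => ->; rewrite mulr0 oppr0 subr0.
  rewrite subr0 mulr1 => E; rewrite -subr_ge0 E subr_ge0.
  apply: le_trans (bphi c c0 c1); apply: le_trans (ler_norm _) _.
  by rewrite normrM e1 mul1r.
rewrite -/A ler_norml -{2}[f y]mul1r key ?normr1// andbT.
by rewrite lerNl -mulN1r key// normrN1.
Qed.

Lemma le0_geom (a C : R) : (forall n, a <= C / 2 ^+ n) -> a <= 0.
Proof.
move=> h; apply: le0_eps => eps e0.
have [n hn] : exists n : nat, C / eps < n%:R.
  by exists (Num.truncn `|C / eps|).+1; apply: le_lt_trans (ler_norm _) _; exact: truncnS_gt.
apply: le_trans (h n) _; rewrite ler_pdivrMr ?exprn_gt0//.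
move: hn; rewrite ltr_pdivrMr// => /ltW/le_trans; apply; rewrite mulrC.
by apply: ler_wpM2l; [exact: ltW|rewrite -natrX ler_nat ltnW// ltn_expl].
Qed.

(** By [flat_taylor], |f y| <= C (K d |y - x|)^n for all n, and the quantity
    between parentheses is at most 1 / 2 near x. *)
Lemma ab_flat x r f : 0 < r -> analytic_bounded (ball x r) f ->
  (forall s, pderiv s f x = 0) -> \forall y \near x, f y = 0.
Proof.
move=> r0 [C [K [C0 K0 h]]] fl.
pose D := K * d%:R; have D0 : 0 <= D by exact: mulr_ge0.
have D1 : 0 < D + 1 by exact: ltr_wpDl.
have rho0 : 0 < 2^-1 / (D + 1) by rewrite divr_gt0.
near=> y.
have xy : ball x r y by near: y; exact: nbhsx_ballx.
apply/eqP; rewrite -normr_le0; apply: (@le0_geom _ C) => n.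
have b0 m : 0 <= C * K ^+ m * m`!%:R by rewrite !mulr_ge0// exprn_ge0.
apply: le_trans (flat_taylor r0 b0 (h n) _ xy) _ => //.
rewrite [leLHS](_ : _ = C * (K * (d%:R * `|y - x|)) ^+ n * (n`!%:R / n`!%:R)); last first.
  by rewrite [in RHS]exprMn exprMn; ring.
rewrite divff ?pnatr_eq0 -?lt0n ?fact_gt0// mulr1 -exprVn.
apply: ler_wpM2l => //; apply: lerXn2r; rewrite ?nnegrE ?invr_ge0// ?mulr_ge0//.
have : ball x (2^-1 / (D + 1)) y by near: y; exact: nbhsx_ballx.
move=> /rball_normE; rewrite ltr_pdivlMr// mulrC mulrA => /ltW; apply: le_trans.
by rewrite -/D; apply: ler_wpM2r => //; rewrite lerDl.
Unshelve. all: by end_near. Qed.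

End dbound.

(** * Limits of functions with bounded derivatives *)

Section linear_form.
Context {R : realType} {d : nat}.

(** Bundled below as a linear map, so that [diff_eps] can identify it with a
    differential. *)
Definition row_form (g : 'I_d -> R) (v : 'rV[R]_d) : R := \sum_i v ord0 i * g i.

Lemma row_form_is_linear g : linear (row_form g).
Proof.
move=> a u v; rewrite /row_form scaler_sumr -big_split; apply: eq_bigr => i _.
by rewrite !mxE mulrDl /= /GRing.scale/= mulrA.
Qed.

HB.instance Definition _ g := GRing.isLinear.Build R 'rV[R]_d R _ (row_form g)
  (row_form_is_linear g).

Lemma row_form_continuous g : continuous (row_form g).
Proof.
have -> : row_form g = \sum_i (fun v : 'rV[R]_d => (v ord0 i *: g i : R)).
  by apply/funext => v; rewrite fct_sumE.
move=> v; apply: (@differentiable_continuous _ _ _ v).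
apply: differentiable_sum => i.
apply: (@differentiableZl _ _ _ (fun v : 'rV[R]_d => v ord0 i)).
exact: differentiable_coord.
Qed.

End linear_form.

Section limits.
Context {R : realType} {d : nat}.
Implicit Types (x y z : 'rV[R]_d) (f g : 'rV[R]_d -> R).

Lemma taylor2_ball f x r B : dbound 2 (ball x r) (fun=> B) f ->
  forall y z, ball x r y -> ball x r z ->
  `|f z - f y - \sum_i (z - y) ord0 i * dpartial i f y| <=
    d%:R * (d%:R * B) * `|z - y| ^+ 2.
Proof.
move=> /dboundS[h hf] y z xy xz.
have [t /andP[t0 t1] ->] := mvt_ball (fun w hw => (h w hw).1) xy xz.
rewrite -sumrB; under eq_bigr do rewrite -mulrBr.
rewrite expr2 [leRHS]mulrA -[d%:R * _ * `|z - y|]mulrA.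
apply: sum_coord_le => i.
have /dboundS[h1 h2] := hf i.
apply: le_trans (lipschitz_ball (fun w hw => (h1 w hw).1) _ xy _) _.
- by move=> w j hw; exact: (dbound0 (h2 j) hw).2.
- exact: ball_segment.
apply: ler_wpM2l.
  apply: mulr_ge0 => //; have [_] := dbound0 (h2 i) xy.
  exact: le_trans.
by rewrite addrC addKr normrZ (ger0_norm t0) ler_piMl.
Qed.

(** Bounded second derivatives make difference quotients of step t approximate the
    partial derivatives with an error O(t) that is uniform in the sequence. As the
    difference quotients converge, the partial derivatives form a Cauchy
    sequence, and the Taylor inequality passes to the limit. Hence pointwise
    convergence of the functions suffices. *)
Lemma limit_differentiable (F : nat -> 'rV[R]_d -> R) f x r B :
  (forall N, dbound 2 (ball x r) (fun=> B) (F N)) ->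
  (forall y, ball x r y -> F ^~ y @ \oo --> f y) ->
  forall y, ball x r y -> differentiable f y /\
    forall i, (fun N => dpartial i (F N) y) @ \oo --> dpartial i f y.
Proof.
move=> hF Ff y xy; have r0 : 0 < r by case: xy.
pose D := d%:R * (d%:R * B).
have B0 : 0 <= B by have [_] := dbound0 (hF 0%N) xy; exact: le_trans.
have D0 : 0 <= D by rewrite !mulr_ge0.
have [rho rho0 yrho] : exists2 rho, 0 < rho & forall z, ball y rho z -> ball x r z.
  apply: cvg_rball; apply: open_nbhs_nbhs; split => //.
  exact: ball_open.
have tay N z : ball x r z ->
    `|F N z - F N y - row_form (fun i => dpartial i (F N) y) (z - y)| <=
    D * `|z - y| ^+ 2.
  by move=> xz; exact: (taylor2_ball (hF N)).
have cv i : cvg ((fun N => dpartial i (F N) y) @ \oo).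
  apply: cauchy_cvg; apply: cauchy_exP => e e0.
  (* The difference quotient of step t is then within e / 2 of the derivative. *)
  pose t := Num.min (rho / 2) (e / 2 / (D + 1)).
  have D1 : 0 < D + 1 by exact: ltr_wpDl.
  have t0 : 0 < t by rewrite lt_min !divr_gt0.
  pose z := y + t *: (delta_mx ord0 i : 'rV[R]_d).
  have zy : z - y = t *: delta_mx ord0 i by rewrite /z addrC addKr.
  have nzy : `|z - y| <= t.
    rewrite zy normrZ (gtr0_norm t0) -[leRHS]mulr1.
    by apply: ler_wpM2l; [exact: ltW|exact: norm_delta].
  have xz : ball x r z.
    apply/yrho/rball_normE; apply: le_lt_trans nzy _.
    apply: (@le_lt_trans _ _ (rho / 2)); first by rewrite /t ge_min lexx.
    by rewrite ltr_pdivrMr// ltr_pMr// ltr1n.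
  have cq : (fun N => (F N z - F N y) / t) @ \oo --> (f z - f y) / t.
    by apply: cvgMl; apply: cvgB; exact: Ff.
  have De : D * t < e / 2.
    apply: (@lt_le_trans _ _ ((D + 1) * t)).
      by rewrite ltr_pM2r// ltrDl.
    by rewrite mulrC -ler_pdivlMr// /t ge_min lexx orbT.
  exists ((f z - f y) / t).
  suff H : \forall N \near \oo, ball ((f z - f y) / t) e (dpartial i (F N) y) by exact: H.
  near=> N.
  have h1 : `|(f z - f y) / t - (F N z - F N y) / t| < e / 2.
    near: N; have /cvgrPdist_lt := cq; apply; exact: divr_gt0.
  have h2 : `|(F N z - F N y) / t - dpartial i (F N) y| <= D * t.
    have E : row_form (fun i => dpartial i (F N) y) (z - y) = t * dpartial i (F N) y.
      rewrite /row_form (bigD1 i)//= big1 ?addr0 => [|j ji].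
        by rewrite zy !mxE !eqxx mulr1.
      by rewrite zy !mxE eqxx (negbTE ji) mulr0 mul0r.
    suff H : `|((F N z - F N y) / t - dpartial i (F N) y) * t| <= D * t * t.
      by move: H; rewrite normrM (gtr0_norm t0) ler_pM2r.
    rewrite mulrBl divfK ?gt_eqF//.
    rewrite [X in _ - X]mulrC -E -mulrA -expr2; apply: le_trans (tay N z xz) _.
    by apply: ler_wpM2l => //; apply: lerXn2r; rewrite ?nnegrE// ltW.
  rewrite -ball_normE /ball_ /=.
  apply: le_lt_trans (ler_distD ((F N z - F N y) / t) _ _) _.
  by rewrite [e]splitr; apply: ltrD => //; exact: le_lt_trans De.
pose g i := lim ((fun N => dpartial i (F N) y) @ \oo).
have cg i : (fun N => dpartial i (F N) y) @ \oo --> g i by exact: cv.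
have lt z : ball x r z -> `|f z - f y - row_form g (z - y)| <= D * `|z - y| ^+ 2.
  move=> xz.
  have cl : (fun N => `|F N z - F N y - row_form (fun i => dpartial i (F N) y) (z - y)|)
      @ \oo --> `|f z - f y - row_form g (z - y)|.
    apply: cvg_norm; apply: cvgB; first by apply: cvgB; exact: Ff.
    by apply: cvg_big => [|i _]; [exact: add_continuous|apply: cvgMr; exact: cg].
  apply: (ler_cvg_to cl (cvg_cst _)).
  by near=> N; exact: tay.
have [df dfE] : differentiable f y /\ 'd f y = row_form g :> (_ -> _).
  apply: diff_eps; first exact: row_form_continuous.
  have D1 : 0 < D + 1 by exact: ltr_wpDl.
  move=> eps e0; have eD : 0 < eps / (D + 1) by exact: divr_gt0.
  near=> z.
  have xz : ball x r z by apply: yrho; near: z; exact: nbhsx_ballx.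
  apply: le_trans (lt z xz) _; rewrite expr2 mulrA; apply: ler_wpM2r => //.
  have : ball y (eps / (D + 1)) z by near: z; exact: nbhsx_ballx.
  move=> /rball_normE; rewrite ltr_pdivlMr// mulrC => /ltW; apply: le_trans.
  by apply: ler_wpM2r => //; rewrite lerDl.
split => // i; suff -> : dpartial i f y = g i by [].
rewrite /dpartial deriveE// dfE /= /row_form (bigD1 i)//= big1 ?addr0 => [|j ji].
  by rewrite !mxE !eqxx mul1r.
by rewrite !mxE eqxx (negbTE ji) mul0r.
Unshelve. all: by end_near. Qed.

(** Apply [limit_differentiable] to the sequence of functions, then to the sequences
    of their partial derivatives, and so on. *)
Lemma limit_dbound (F : nat -> 'rV[R]_d -> R) f x r b :
  (forall N k, dbound k (ball x r) b (F N)) ->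
  (forall y, ball x r y -> F ^~ y @ \oo --> f y) ->
  forall k, dbound k (ball x r) b f.
Proof.
have h0 b' F' f' : (forall N k, dbound k (ball x r) b' (F' N)) ->
    (forall y, ball x r y -> F' ^~ y @ \oo --> f' y) ->
    forall y, ball x r y -> [/\ differentiable f' y, `|f' y| <= b' 0%N &
    forall i, (fun N => dpartial i (F' N) y) @ \oo --> dpartial i f' y].
  move=> hF Ff y xy.
  pose B := Num.max (b' 0%N) (Num.max (b' 1%N) (b' 2%N)).
  have hB N : dbound 2 (ball x r) (fun=> B) (F' N).
    have /dboundS[h1 h2] := hF N 2%N.
    apply/dboundS; split.
      by move=> z /h1[? hz]; split => //; apply: le_trans hz _; rewrite le_max lexx.
    move=> i; have /dboundS[h3 h4] := h2 i.
    apply/dboundS; split.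
      by move=> z /h3[? hz]; split => //; apply: le_trans hz _; rewrite !le_max lexx orbT.
    move=> j; have [h5 _] := h4 j; split => // z /h5[? hz]; split => //.
    by apply: le_trans hz _; rewrite !le_max lexx !orbT.
  have [df cf] := limit_differentiable hB Ff xy; split => //.
  apply: (ler_cvg_to (cvg_norm (Ff y xy)) (cvg_cst _)).
  by near=> N; exact: (dbound0 (hF N 0%N) xy).2.
move=> hF Ff k; elim: k b F f hF Ff => [|k IH] b F f hF Ff.
  by split => // y xy; have [] := h0 _ _ _ hF Ff y xy.
apply/dboundS; split => [y xy|i]; first by have [] := h0 _ _ _ hF Ff y xy.
apply: (IH _ (fun N => dpartial i (F N))).
  by move=> N k'; have /dboundS[_] := hF N k'.+1.
by move=> y xy; have [_ _] := h0 _ _ _ hF Ff y xy.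
Unshelve. all: by end_near. Qed.

End limits.

(** * Power series *)

Section power_series.
Context {R : realType} {d : nat}.
Implicit Types (x y z : 'rV[R]_d) (f g : 'rV[R]_d -> R)
  (a : {ffun 'I_d -> nat}).

Definition degree a : nat := (\sum_i a i)%N.

(** The exponent of the derivative of a monomial in the direction i. *)
Definition lower i a : {ffun 'I_d -> nat} :=
  [ffun j => if j == i then (a j).-1 else a j].

Lemma degree_lower i a : (0 < a i)%N -> degree a = (degree (lower i a)).+1.
Proof.
move=> ai; rewrite /degree (bigD1 i)//= [in RHS](bigD1 i)//= ffunE eqxx -addSn.
rewrite prednK//; congr addn; apply: eq_bigr => j ji.
by rewrite ffunE (negbTE ji).
Qed.

Lemma monomial_lower j a (h : 'rV[R]_d) : (0 < a j)%N ->
  monomial a h = h ord0 j * monomial (lower j a) h.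
Proof.
move=> aj; rewrite /monomial (bigD1 j)//= [in RHS](bigD1 j)//= ffunE eqxx mulrA.
rewrite -exprS prednK//; congr (_ * _); apply: eq_bigr => i ij.
by rewrite ffunE (negbTE ij).
Qed.

Lemma monomial_diff a x y : differentiable (fun y => monomial a (y - x)) y /\
  forall i, dpartial i (fun y => monomial a (y - x)) y =
    (a i)%:R * monomial (lower i a) (y - x).
Proof.
have [n] := ubnP (degree a); elim: n a => // n IH a an.
have [/existsP[j aj]|/existsPn a0] := boolP [exists j, (0 < a j)%N]; last first.
  have {}a0 j : a j = 0%N by apply/eqP; have := a0 j; rewrite lt0n negbK.
  have -> : (fun y => monomial a (y - x)) = cst 1.
    by apply/funext => z; rewrite /monomial big1// => j _; rewrite a0 expr0.
  split; first exact: differentiable_cst.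
  by move=> i; rewrite dpartial_cst a0 mul0r.
have [|dl el] := IH (lower j a).
  by move: an; rewrite (degree_lower aj).
have -> : (fun y => monomial a (y - x)) =
    (fun y => y ord0 j - x ord0 j) * (fun y => monomial (lower j a) (y - x)).
  by apply/funext => z; rewrite (monomial_lower _ aj) !mxE.
have dc : differentiable (fun y : 'rV[R]_d => y ord0 j - x ord0 j) y.
  by apply: differentiableB; [exact: differentiable_coord|exact: differentiable_cst].
split; first exact: differentiableM.
move=> i; rewrite dpartialM// el.
have -> : dpartial i (fun y : 'rV[R]_d => y ord0 j - x ord0 j) y = (i == j)%:R.
  rewrite -(@dpartial_coord _ _ i j y) /dpartial deriveB ?derive_cst ?subr0//.
    by apply: diff_derivable; exact: differentiable_coord.
have yx : (y - x) ord0 j = y ord0 j - x ord0 j by rewrite !mxE.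
have [->|ij] := eqVneq i j.
  rewrite ffunE eqxx mul1r; have [a1|a1] := posnP (a j).-1.
    have -> : a j = 1%N by rewrite -(prednK aj) a1.
    by rewrite mul0r mulr0 addr0 mul1r.
  rewrite mulrCA -yx -monomial_lower ?ffunE ?eqxx//.
  by rewrite -{1}[monomial _ _]mul1r -mulrDl nat1r prednK.
rewrite mul0r add0r ffunE (negbTE ij) mulrCA; congr (_ * _).
rewrite -yx; have -> : lower i (lower j a) = lower j (lower i a).
  by apply/ffunP => k; rewrite !ffunE; do 2 case: eqP => //.
by rewrite -monomial_lower// ffunE eq_sym (negbTE ij).
Qed.

(** A derivative of order n multiplies a monomial of degree m by at most the
    falling factorial m (m - 1) ... (m - n + 1) and lowers its degree by n. *)
Lemma monomial_dbound a x (rho : R) k : 0 < rho ->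
  dbound k (ball x rho)
    (fun n => (degree a ^_ n)%:R * rho ^+ (degree a - n))
    (fun y => monomial a (y - x)).
Proof.
move=> rho0.
have bd a' y : ball x rho y -> `|monomial a' (y - x)| <= rho ^+ degree a'.
  move=> /rball_normE yx; rewrite /monomial normr_prod /degree expr_sum.
  apply: ler_prod => i _; rewrite normr_ge0 normrX; apply: lerXn2r; rewrite ?nnegrE//.
    exact: ltW.
  by apply: le_trans (coord_le_norm _ _) _; exact: ltW.
elim: k a => [|k IH] a.
  split => // y xy; split; first exact: (monomial_diff a x y).1.
  by rewrite ffactn0 mul1r subn0; exact: bd.
apply/dboundS; split=> [y xy|i].
  split; first exact: (monomial_diff a x y).1.
  by rewrite ffactn0 mul1r subn0; exact: bd.
have oB : open (ball x rho) by exact: ball_open.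
have := dboundZ (a i)%:R oB (IH (lower i a)).
have -> : (fun y => (a i)%:R * monomial (lower i a) (y - x)) =
    dpartial i (fun y => monomial a (y - x)).
  by apply/funext => y; rewrite (monomial_diff a x y).2.
apply: dbound_mono => // n; rewrite normr_nat.
have [ai|] := posnP (a i).
  by rewrite ai mul0r mulr_ge0// exprn_ge0// ltW.
move=> ai; rewrite (degree_lower ai) subSS mulrA -natrM.
apply: ler_wpM2r; first by rewrite exprn_ge0// ltW.
rewrite ler_nat ffactSS leq_mul2r -(degree_lower ai); apply/orP; right.
by rewrite /degree (bigD1 i)//= leq_addr.
Qed.

(** This is the term of index n in the binomial expansion of (rho + T)^m. *)
Lemma ffact_binomial_le m n (rho T : R) : 0 < rho -> 0 < T ->
  (m ^_ n)%:R * rho ^+ (m - n) <= n`!%:R / T ^+ n * (rho + T) ^+ m.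
Proof.
move=> rho0 T0; have [mn|nm] := ltnP m n.
  rewrite ffact_small// mul0r mulr_ge0// ?exprn_ge0 ?addr_ge0 ?ltW//.
  by rewrite divr_gt0// ?exprn_gt0// ltr0n fact_gt0.
rewrite -bin_ffact natrM.
rewrite [leLHS](_ : _ = n`!%:R / T ^+ n * (rho ^+ (m - n) * T ^+ n *+ 'C(m, n))); last first.
  have : T ^+ n != 0 by rewrite expf_neq0// gt_eqF.
  rewrite -[(rho ^+ _ * _) *+ _]mulr_natr.
  by move: (T ^+ n) (n`!%:R : R) ('C(m, n)%:R : R) => t f c t0; field.
apply: ler_wpM2l; first by rewrite divr_ge0// exprn_ge0// ltW.
have nm' : (n < m.+1)%N by [].
rewrite exprDn (bigD1 (Ordinal nm'))//= lerDl; apply: sumr_ge0 => i _.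
by rewrite mulrn_wge0// mulr_ge0// exprn_ge0// ltW.
Qed.

Lemma summable_cubes (g : {ffun 'I_d -> nat} -> R) :
  summable [set: {ffun 'I_d -> nat}] (fun a => (g a)%:E) ->
  exists2 C, 0 <= C & forall N, \sum_(b : {ffun 'I_d -> 'I_N})
    `|g [ffun i => nat_of_ord (b i)]| <= C.
Proof.
move=> sg; exists (fine (\esum_(a in [set: {ffun 'I_d -> nat}]) `|(g a)%:E|%E)).
  by apply: fine_ge0; apply: esum_ge0 => a _; exact: abse_ge0.
move=> N.
pose emb (b : {ffun 'I_d -> 'I_N}) : {ffun 'I_d -> nat} := [ffun i => nat_of_ord (b i)].
have emb_inj : injective emb.
  move=> b b' /ffunP h; apply/ffunP => i; have := h i; rewrite !ffunE.
  exact: val_inj.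
rewrite -lee_fin fineK; last by rewrite -summableE.
apply: esum_ge; exists [set` [seq emb b | b : {ffun 'I_d -> 'I_N}]].
  by split => //; exact: finite_seq.
rewrite -fsbig_seq; last by rewrite map_inj_uniq// enum_uniq.
by rewrite big_map big_enum/= -sumEFin.
Qed.

(** At the corner (rho + T, ..., rho + T) of a cube, absolute convergence bounds
    the sums of |c_a| (rho + T)^|a|. By [ffact_binomial_le] this bounds the
    derivatives of order n of the partial sums on the smaller cube of radius rho by
    C n! / T^n, uniformly, and [limit_dbound] passes to the limit. *)
Lemma analytic_at_bounded f x : analytic_at f x ->
  exists2 rho, 0 < rho & analytic_bounded (ball x rho) f.
Proof.
move=> [c [r [r0 h]]].
pose rho := r / 4; pose T := r / 4.
have rho0 : 0 < rho by rewrite divr_gt0.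
have T0 : 0 < T by rewrite divr_gt0.
pose y0 : 'rV[R]_d := x + const_mx (rho + T).
have rT : 0 < rho + T by rewrite addr_gt0.
have xy0 : ball x r y0.
  apply/rball_normE; rewrite /y0 addrC addKr.
  apply: (@le_lt_trans _ _ (rho + T)); last by rewrite /rho /T; lra.
  by apply: norm_le_coord => [|i]; [exact: ltW|rewrite mxE gtr0_norm].
have [/summable_cubes[C C0 hC] _] := h y0 xy0.
have mono0 a : monomial a (y0 - x) = (rho + T) ^+ degree a.
  rewrite /monomial /degree expr_sum; apply: eq_bigr => i _.
  by rewrite /y0 addrC addKr mxE.
exists rho => //; exists C, T^-1; split => //; first by rewrite invr_ge0 ltW.
pose emb N (b : {ffun 'I_d -> 'I_N}) : {ffun 'I_d -> nat} := [ffun i => nat_of_ord (b i)].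
pose F N y := \sum_(b : {ffun 'I_d -> 'I_N}) c (emb N b) * monomial (emb N b) (y - x).
apply: (@limit_dbound _ _ F) => [N k|y xy]; last first.
  have [] := h y _; last by [].
  apply: le_ball xy; rewrite /rho; lra.
have H1 : dbound k (ball x rho) (fun n => \sum_(b : {ffun 'I_d -> 'I_N})
    `|c (emb N b)| * ((degree (emb N b) ^_ n)%:R * rho ^+ (degree (emb N b) - n)))
    (F N).
  rewrite /F; elim: (index_enum _) => [|b s IH].
    under [X in dbound _ _ _ X]eq_fun do rewrite big_nil.
    by apply: dbound_cst => [|n]; rewrite ?normr0 big_nil.
  have oB : open (ball x rho) by exact: ball_open.
  have := dboundD oB
    (dboundZ (c (emb N b)) oB (monomial_dbound (emb N b) x k rho0)) IH.
  have -> : (fun y => \sum_(b0 <- b :: s) c (emb N b0) * monomial (emb N b0) (y - x)) =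
      (fun y => c (emb N b) * monomial (emb N b) (y - x)) +
      (fun y => \sum_(b <- s) c (emb N b) * monomial (emb N b) (y - x)).
    by apply/funext => y; rewrite big_cons.
  by apply: dbound_mono => // n; rewrite big_cons.
apply: dbound_mono H1 => // n.
apply: (@le_trans _ _ (\sum_(b : {ffun 'I_d -> 'I_N})
    n`!%:R / T ^+ n * `|c (emb N b) * monomial (emb N b) (y0 - x)|)).
  apply: ler_sum => b _; rewrite mono0 normrM [leRHS]mulrCA; apply: ler_wpM2l => //.
  by rewrite normrX (gtr0_norm rT); exact: ffact_binomial_le.
rewrite -mulr_sumr exprVn [leRHS](_ : _ = n`!%:R / T ^+ n * C); last by ring.
apply: ler_wpM2l; first by rewrite divr_ge0// exprn_ge0// ltW.
exact: hC.
Qed.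

End power_series.

(** * Null sets *)

Section null_sets.
Context {R : realType} {d : nat}.
Local Notation cube := ('rV[R]_d * R)%type.
Implicit Types (L : seq cube) (A B : set 'rV[R]_d).

Definition covered L : set 'rV[R]_d :=
  [set y | exists2 p, p \in L & ball p.1 p.2 y].

Definition cost L : R := \sum_(p <- L) p.2 ^+ d.

Definition positive_cubes L := forall p, p \in L -> 0 < p.2.

(** Balls for the norm of rows are cubes. Covers are sequences of finite lists of
    cubes rather than sequences of cubes, because in dimension 0 a single cube has
    cost 1 and the empty set must still be null. *)
Definition null_set A := forall eps : R, 0 < eps -> exists L : nat -> seq cube,
  [/\ forall k, positive_cubes (L k), A `<=` \bigcup_k covered (L k) &
      forall N, \sum_(k < N) cost (L k) <= eps].

Lemma null_subset A B : A `<=` B -> null_set B -> null_set A.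
Proof.
move=> AB nB eps e0; have [L [pL BL cL]] := nB eps e0; exists L; split => //.
exact: subset_trans BL.
Qed.

Lemma null_finite A :
  (forall eps : R, 0 < eps -> exists L,
    [/\ positive_cubes L, A `<=` covered L & cost L <= eps]) -> null_set A.
Proof.
move=> h eps e0; have [L [pL AL cL]] := h eps e0.
exists (fun k => if k == 0%N then L else [::]); split.
- by move=> [|k].
- by move=> y /AL Ly; exists 0%N.
- case=> [|N]; first by rewrite big_ord0 ltW.
  rewrite big_ord_recl/= big1 ?addr0//.
  by move=> k _; rewrite /cost big_nil.
Qed.

Lemma null_set0 : null_set set0.
Proof.
apply: null_finite => eps e0; exists [::]; split => //.
by rewrite /cost big_nil ltW.
Qed.

(** Cover the n-th set at cost eps / 2^(n+1), and enumerate the double sequence of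
    lists along diagonals. *)
Lemma null_bigcup (A : nat -> set 'rV[R]_d) : (forall n, null_set (A n)) ->
  null_set (\bigcup_n A n).
Proof.
move=> nA eps e0.
have e2 n : 0 < eps / 2 ^+ n.+1 by rewrite divr_gt0// exprn_gt0.
have /choice[L hL] n := nA n _ (e2 n).
have pL n k : positive_cubes (L n k) by have [] := hL n.
pose L' n := flatten [seq L i (n - i)%N | i <- iota 0 n.+1].
exists L'; split.
- by move=> n p /flattenP[s /mapP[i _ ->]]; exact: pL.
- move=> y [n _ Any]; have [_ /(_ _ Any)[k _ [p pk py]] _] := hL n.
  exists (n + k)%N => //; exists p => //; apply/flattenP; exists (L n k) => //.
  apply/mapP; exists n; first by rewrite mem_iota /= add0n ltnS leq_addr.
  by rewrite addKn.
- move=> N; apply: (@le_trans _ _ (\sum_(i < N) eps / 2 ^+ i.+1)).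
    have -> : \sum_(k < N) cost (L' k) =
        \sum_(i < N) \sum_(j < N - i) cost (L i j).
      elim: N => [|N IH]; first by rewrite !big_ord0.
      rewrite big_ord_recr/= IH [RHS]big_ord_recr/= subSnn big_ord1.
      have -> : cost (L' N) = \sum_(i < N.+1) cost (L i (N - i)%N).
        rewrite /L' /cost big_flatten big_map.
        by rewrite -[X in iota 0 X]subn0 -/(index_iota _ _) big_mkord.
      rewrite [X in _ + X]big_ord_recr/= subnn addrA; congr (_ + _).
      rewrite -big_split/=; apply: eq_bigr => i _.
      by rewrite subSn ?big_ord_recr// ltnW.
    apply: ler_sum => i _; have [_ _] := hL i; exact.
  suff -> : \sum_(i < N) eps / 2 ^+ i.+1 = eps - eps / 2 ^+ N.
    by rewrite gerBl divr_ge0// ?exprn_ge0// ltW.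
  elim: N => [|N IH]; first by rewrite big_ord0 expr0 divr1 subrr.
  rewrite big_ord_recr/= IH exprS.
  have : 2 ^+ N != 0 :> R by rewrite expf_neq0.
  by move: (2 ^+ N : R) => t t0; field.
Qed.

Lemma null_countable_union (I : countType) (A : I -> set 'rV[R]_d) (P : set I) :
  (forall i, P i -> null_set (A i)) -> null_set (\bigcup_(i in P) A i).
Proof.
move=> nA.
pose A' n := if choice.unpickle n is Some i then [set y | P i /\ A i y] else set0.
apply: (@null_subset _ (\bigcup_n A' n)).
  by move=> y [i Pi Aiy]; exists (choice.pickle i) => //; rewrite /A' choice.pickleK.
apply: null_bigcup => n; rewrite /A'; case: (choice.unpickle n) => [i|]; last exact: null_set0.
have [Pi|nPi] := pselect (P i).
  by apply: null_subset (nA i Pi) => y [].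
by apply: null_subset null_set0 => y [].
Qed.

End null_sets.

Section ball_not_null.
Context {R : realType} {d : nat}.

(** An interval of length 2 s contains at most 2 s / h + 1 points of a grid of
    step h. *)
Lemma card_spread (N : nat) (A : {pred 'I_N}) (h s : R) : 0 < h -> 0 < s ->
  (forall k l, k \in A -> l \in A -> (l%:R - k%:R) * h < 2 * s) ->
  #|A|%:R <= 2 * s / h + 1.
Proof.
move=> h0 s0 sp; have [k0 k0A|A0] := pickP (mem A); last first.
  by rewrite eq_card0 ?addr_ge0// ?divr_ge0// ?mulr_ge0// ltW.
have [m mA mmin] := arg_minnP (fun k : 'I_N => (k : nat)) k0A.
pose q := Num.truncn (2 * s / h).
have sq : 0 <= 2 * s / h by rewrite divr_ge0// ?mulr_ge0// ltW.
have inq k : k \in A -> (k - m < q.+1)%N.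
  move=> kA; have mk : (m <= k)%N by exact: mmin.
  rewrite ltnS /q truncn_ge_nat// natrB//.
  by rewrite ler_pdivlMr//; apply/ltW/sp.
have inj : {in A &, injective (fun k : 'I_N => inord (k - m) : 'I_q.+1)}.
  move=> k l kA lA /(congr1 val) /=.
  rewrite !inordK ?inq// => e; apply: val_inj => /=.
  by rewrite -(subnK (mmin k kA)) e subnK//; exact: mmin.
have : (#|A| <= #|'I_q.+1|)%N by rewrite -(card_in_image inj); exact: max_card.
rewrite card_ord -(ler_nat R) => /le_trans; apply.
by rewrite -natr1 lerD2r truncn_le.
Qed.

Lemma card_cover (T : finType) (I : eqType) (L : seq I) (P : I -> pred T) :
  (forall k, exists2 p, p \in L & P p k) -> (#|T| <= \sum_(p <- L) #|P p|)%N.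
Proof.
move=> h; rewrite -sum1_card.
have -> : (\sum_(p <- L) #|P p| = \sum_(k : T) \sum_(p <- L) P p k)%N.
  rewrite exchange_big; apply: eq_bigr => p _.
  by rewrite -sum1_card big_mkcond; apply: eq_bigr => k _; rewrite unfold_in; case: (P p k).
apply: leq_sum => k _; have [p pL Ppk] := h k.
by rewrite (big_rem p)//= Ppk.
Qed.

Lemma cube_count (c alpha : 'rV[R]_d) (s h : R) (N : nat) : 0 < h -> 0 < s ->
  #|[pred k : {ffun 'I_d -> 'I_N} |
     `[< ball c s (alpha + \row_i (h * (k i)%:R)) >]]|%:R <= (2 * s / h + 1) ^+ d.
Proof.
move=> h0 s0.
pose F (i : 'I_d) := [pred k : 'I_N | `|alpha ord0 i + h * k%:R - c ord0 i| < s].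
apply: (@le_trans _ _ (#|family F|%:R)).
  rewrite ler_nat; apply: subset_leq_card; apply/fintype.subsetP => k.
  move=> kin; have /asboolP[_ kb] : `[< ball c s (alpha + \row_i (h * (k i)%:R)) >] := kin.
  apply/familyP => i; rewrite inE.
  have := kb ord0 i; rewrite -ball_normE /ball_/= distrC !mxE.
  by [].
rewrite card_family.
rewrite (_ : foldr _ _ _ = (\prod_(i < d) #|F i|)%N); last first.
  by rewrite foldrE big_image.
rewrite natr_prod -[d in _ ^+ d]card_ord -prodr_const.
apply: ler_prod => i _; rewrite ler0n; apply: card_spread => // k l.
rewrite !inE !ltr_norml => /andP[k1 k2] /andP[l1 l2]; lra.
Qed.

(** Compactness extracts from a cover of small cost a finite one of a smaller closed
    cube. A grid of N^d points in this cube meets a cube of radius s in at most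
    (4 s N / r)^d points, once the step r / N is small compared with all radii; so
    N^d <= (4 N / r)^d * cost. *)
Lemma ball_not_null (y : 'rV[R]_d) (r : R) : 0 < r -> ~ null_set (ball y r).
Proof.
move=> r0 nb.
have r4 : 0 < (r / 4) ^+ d / 2 by rewrite divr_gt0// exprn_gt0// divr_gt0.
have [L [pL bL cL]] := nb _ r4.
pose K := [set z : 'rV[R]_d | forall i, `[y ord0 i - r / 2, y ord0 i + r / 2]%classic (z ord0 i)].
have Kc : compact K.
  apply: (@rV_compact R d (fun i => `[y ord0 i - r / 2, y ord0 i + r / 2]%classic)).
  by move=> i; exact: segment_compact.
have KL : K `<=` \bigcup_(k in setT) covered (L k).
  move=> z Kz; apply: bL; apply/rball_normE.
  apply: (@le_lt_trans _ _ (r / 2)); last by rewrite ltr_pdivrMr// ltr_pMr// ltr1n.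
  apply: norm_le_coord => [|i]; first by rewrite divr_ge0// ltW.
  have := Kz i; rewrite /= in_itv/= !mxE => /andP[h1 h2].
  by rewrite ler_norml; apply/andP; split; lra.
have oL k : [set: nat] k -> open (covered (L k)).
  move=> _; rewrite (_ : covered _ = \bigcup_(p in [set p | p \in L k]) ball p.1 p.2).
    by apply: bigcup_open => p _; exact: ball_open.
  by apply/seteqP; split => z [p]; exists p.
move: Kc; rewrite compact_cover => /(_ _ _ _ oL KL)[D _ KD].
pose n := (\max_(k : D) val k).+1.
pose LL := flatten [seq L k | k <- iota 0 n].
have pLL : positive_cubes LL by move=> p /flattenP[s /mapP[k _ ->]]; exact: pL.
have KLL : K `<=` covered LL.
  move=> z /KD[k kD [p pk pz]]; exists p => //; apply/flattenP; exists (L k) => //.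
  apply/mapP; exists k => //; rewrite mem_iota /= add0n /n ltnS.
  exact: (@leq_bigmax _ (fun k : D => val k) [` kD]%fset).
have cLL : cost LL <= (r / 4) ^+ d / 2.
  rewrite /LL /cost big_flatten big_map.
  by rewrite -[X in iota 0 X]subn0 -/(index_iota _ _) big_mkord; exact: cL.
(* With N > S, the step r / N is less than the side 2 * p.2 of every cube. *)
pose S := \sum_(p <- LL) r / (2 * p.2).
pose N := (Num.truncn S).+1.
have N0 : 0 < N%:R :> R by rewrite ltr0n.
have SN : S < N%:R by exact: truncnS_gt.
have sN p : p \in LL -> 1 <= 2 * p.2 / (r / N%:R).
  move=> pin; have p0 := pLL p pin.
  have : r / (2 * p.2) <= S.
    rewrite /S (big_rem p)//= lerDl big_seq; apply: sumr_ge0 => q /mem_rem /pLL q0.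
    by rewrite divr_ge0// ?mulr_ge0// ltW.
  move=> /le_lt_trans/(_ SN); rewrite ltr_pdivrMr ?mulr_gt0// => h.
  rewrite ler_pdivlMr ?divr_gt0// mul1r ler_pdivrMr//; apply/ltW.
  by rewrite mulrC.
pose alpha := y - const_mx (r / 2).
have cov (k : {ffun 'I_d -> 'I_N}) : exists2 p, p \in LL &
    `[< ball p.1 p.2 (alpha + \row_i ((r / N%:R) * (k i)%:R)) >].
  have [|p pin pb] := KLL (alpha + \row_i ((r / N%:R) * (k i)%:R)); last first.
    by exists p => //; apply/asboolP.
  move=> i; rewrite /= in_itv/= !mxE.
  have h1 : 0 <= r / N%:R * (k i)%:R by rewrite mulr_ge0// divr_ge0// ltW.
  have h2 : r / N%:R * (k i)%:R <= r.
    rewrite -mulrA -[leRHS]mulr1; apply: ler_wpM2l; first exact: ltW.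
    by rewrite mulrC ler_pdivrMr// mul1r ler_nat ltnW.
  by apply/andP; split; lra.
have := card_cover cov; rewrite -(ler_nat R) card_ffun !card_ord natrX natr_sum.
apply/negP; rewrite -ltNge.
apply: (@le_lt_trans _ _ (\sum_(p <- LL) (4 * p.2 / (r / N%:R)) ^+ d)).
  rewrite big_seq [leRHS]big_seq; apply: ler_sum => p pin.
  have p0 := pLL p pin.
  have rN : 0 < r / N%:R by rewrite divr_gt0.
  apply: le_trans (cube_count _ _ _ rN p0) _.
  apply: lerXn2r; rewrite ?nnegrE.
  - by rewrite addr_ge0// divr_ge0// ?mulr_ge0// ltW.
  - by rewrite divr_ge0// ?mulr_ge0// ltW.
  - have -> : 4 * p.2 / (r / N%:R) = 2 * p.2 / (r / N%:R) + 2 * p.2 / (r / N%:R).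
      by rewrite -mulrDl -mulrDl; congr (_ * _ / _); lra.
    by rewrite lerD2l sN.
have -> : \sum_(p <- LL) (4 * p.2 / (r / N%:R)) ^+ d = N%:R ^+ d * ((4 / r) ^+ d * cost LL).
  rewrite /cost !mulr_sumr; apply: eq_bigr => p _; rewrite -!exprMn; congr (_ ^+ _).
  by field; rewrite !gt_eqF.
rewrite gtr_pMr ?exprn_gt0//.
apply: (@le_lt_trans _ _ ((4 / r) ^+ d * ((r / 4) ^+ d / 2))).
  by apply: ler_wpM2l => //; rewrite exprn_ge0// divr_ge0// ltW.
rewrite mulrA -exprMn (_ : 4 / r * (r / 4) = 1) ?expr1n ?mul1r ?invf_lt1 ?ltr1n//.
by field; rewrite gt_eqF.
Qed.

End ball_not_null.

(** * Sets with small image *)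

Section thin.
Context {R : realType}.

Lemma grid_approx (rho t : R) (N : nat) : (0 < N)%N -> 0 < rho -> `|t| <= rho ->
  exists k : 'I_N, `|t - (- rho + 2 * rho * k%:R / N%:R)| <= 2 * rho / N%:R.
Proof.
move=> N0 rho0; rewrite ler_norml => /andP[t1 t2].
have NR : 0 < N%:R :> R by rewrite ltr0n.
have r2 : 0 < 2 * rho by rewrite mulr_gt0.
pose q := Num.truncn ((t + rho) * N%:R / (2 * rho)).
have x0 : 0 <= (t + rho) * N%:R / (2 * rho).
  have t3 : 0 <= t + rho by lra.
  by rewrite divr_ge0 ?mulr_ge0// ltW.
have /andP[q1 q2] := truncn_itv x0; rewrite -/q in q1 q2.
have hN : 0 < 2 * rho / N%:R by rewrite divr_gt0.
have q1' : 2 * rho * q%:R / N%:R <= t + rho.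
  by move: q1; rewrite ler_pdivlMr// ler_pdivrMr// mulrC.
have q2' : t + rho < 2 * rho * q%:R / N%:R + 2 * rho / N%:R.
  move: q2; rewrite ltr_pdivrMr// -ltr_pdivlMr// => /lt_le_trans; apply.
  by rewrite -natr1 le_eqVlt; apply/orP; left; apply/eqP; ring.
have [qN|Nq] := ltnP q N.
  by exists (Ordinal qN); rewrite /= ler_norml; apply/andP; split; lra.
have N1 : (N.-1 < N)%N by rewrite prednK.
exists (Ordinal N1); rewrite /=.
have Nq' : 2 * rho <= 2 * rho * q%:R / N%:R.
  by rewrite ler_pdivlMr// ler_wpM2l ?ler_nat// ltW.
have -> : 2 * rho * N.-1%:R / N%:R = 2 * rho - 2 * rho / N%:R.
  have -> : N.-1%:R = N%:R - 1 :> R by rewrite -[in RHS](prednK N0) -natr1 addrK.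
  by field; rewrite gt_eqF.
by rewrite ler_norml; apply/andP; split; lra.
Qed.

(** A slab of thickness tau around the hyperplane orthogonal to l. Choose i with
    |l_i| = 1: the coordinates other than i lie in one of N^d cells, and the
    equation of the hyperplane then determines the coordinate i up to the error of
    the other coordinates and the thickness. So N^d cubes suffice, instead of
    N^(d+1) for a ball. *)
Lemma slab_grid d (eta tau : R) (y0 l : 'rV[R]_d.+1) (i : 'I_d.+1) (N : nat) :
  (0 < N)%N -> 0 < eta -> 0 <= tau ->
  `|l ord0 i| = 1 -> `|l| <= 1 ->
  exists cen : {ffun 'I_d -> 'I_N} -> 'rV[R]_d.+1, forall y,
    `|y - y0| <= eta -> `|\sum_j l ord0 j * (y - y0) ord0 j| <= tau ->
    exists m, `|y - cen m| <= tau + d.+1%:R * (2 * eta / N%:R).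
Proof.
move=> N0 eta0 tau0 li l1.
pose b (m : {ffun 'I_d -> 'I_N}) (j : 'I_d) : R := - eta + 2 * eta * (m j)%:R / N%:R.
have H0 : 0 <= 2 * eta / N%:R by rewrite divr_ge0 ?mulr_ge0// ltW.
exists (fun m => y0 + \row_j (if unlift i j is Some j' then b m j'
  else - (l ord0 i)^-1 * \sum_j' l ord0 (lift i j') * b m j')) => y hy hl.
have /choice[m hm] j : exists k : 'I_N,
    `|(y - y0) ord0 (lift i j) - (- eta + 2 * eta * k%:R / N%:R)| <= 2 * eta / N%:R.
  by apply: grid_approx => //; apply: le_trans hy; exact: coord_le_norm.
exists (finfun m); apply: norm_le_coord => [|j].
  by rewrite addr_ge0// mulr_ge0.
have E M : (y - (y0 + M)) ord0 j = (y - y0) ord0 j - M ord0 j.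
  by rewrite !mxE opprD addrA.
rewrite E [(\row_j0 _) ord0 j]mxE.
case: unliftP => [j' ->|->].
  rewrite /b ffunE; apply: le_trans (hm j') _.
  rewrite -[leLHS]mul1r; apply: ler_wpDl => //; apply: ler_wpM2r => //.
  by rewrite ler1n.
have li0 : l ord0 i != 0 by rewrite -normr_gt0 li.
have -> : (y - y0) ord0 i - - (l ord0 i)^-1 * \sum_j' l ord0 (lift i j') * b (finfun m) j' =
    (l ord0 i)^-1 * (\sum_j l ord0 j * (y - y0) ord0 j -
      \sum_j' l ord0 (lift i j') * ((y - y0) ord0 (lift i j') - b (finfun m) j')).
  rewrite (bigD1_ord i)//=.
  have -> : \sum_(j' < d) l ord0 (lift i j') * ((y - y0) ord0 (lift i j') - b (finfun m) j') =
      \sum_(j' < d) l ord0 (lift i j') * (y - y0) ord0 (lift i j') -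
      \sum_(j' < d) l ord0 (lift i j') * b (finfun m) j'.
    by rewrite -sumrB; apply: eq_bigr => j' _; rewrite mulrBr.
  move: (\sum_(j' < d) _ * (y - y0) _ _) (\sum_(j' < d) _ * b _ _)
    ((y - y0) ord0 i) (l ord0 i) li0 => S1 S2 t c c0.
  by field.
rewrite normrM normfV li invr1 mul1r; apply: le_trans (ler_normB _ _) _.
apply: lerD => //; apply: le_trans (ler_norm_sum _ _ _) _.
apply: (@le_trans _ _ (\sum_(j < d) 2 * eta / N%:R)).
  apply: ler_sum => j' _; rewrite normrM -[leRHS]mul1r /b ffunE.
  by apply: ler_pM => //; apply: le_trans l1; exact: coord_le_norm.
by rewrite sumr_const card_ord -[X in X <= _]mulr_natl ler_wpM2r// ler_nat.
Qed.

Lemma cost_const d (s : R) (L : seq ('rV[R]_d * R)) :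
  (forall p, p \in L -> p.2 = s) -> cost L = (size L)%:R * s ^+ d.
Proof.
move=> h; rewrite /cost big_seq (eq_bigr (fun=> s ^+ d)) => [|p /h ->//].
by rewrite -big_seq big_const_seq count_predT iter_addr_0 mulr_natl.
Qed.

(** The equidimensional theorem of Sard, for a relation G between parameters and
    values with a quadratic estimate in one direction l. Divide the parameters in
    N^d cells. The values over a cell lie in a ball of radius O(1/N) and in a slab
    of thickness O(1/N^2), hence by [slab_grid] in N^(d-1) cubes of radius
    O(1/N^2). The total cost is O(N^d N^(d-1) / N^(2d)) = O(1/N). *)
Lemma null_thin d (G : set ('rV[R]_d * 'rV[R]_d)) (rho C : R) :
  (forall g, G g -> `|g.1| <= rho) ->
  (forall g, G g -> exists l : 'rV[R]_d, [/\ exists i, `|l ord0 i| = 1, `|l| <= 1 &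
     forall g', G g' -> `|\sum_j l ord0 j * (g'.2 - g.2) ord0 j| <= C * `|g'.1 - g.1| ^+ 2]) ->
  (forall g g', G g -> G g' -> `|g'.2 - g.2| <= C * `|g'.1 - g.1|) ->
  null_set [set g.2 | g in G].
Proof.
case: d G => [|d] G hrho hl hlip.
  apply: null_subset (@null_set0 R 0) => y [g Gg _].
  by have [l [[[]]]] := hl g Gg.
wlog C1 : C hl hlip / 0 < C.
  move=> W; apply: (W (`|C| + 1)) => [g Gg|g g' Gg Gg'|]; last exact: ltr_wpDl.
  - have [l [h1 h2 h3]] := hl g Gg; exists l; split => // g' Gg'.
    apply: le_trans (h3 g' Gg') _; apply: ler_wpM2r; first exact: exprn_ge0.
    by apply: le_trans (ler_norm _) _; rewrite lerDl.
  - apply: le_trans (hlip g g' Gg Gg') _; apply: ler_wpM2r => //.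
    by apply: le_trans (ler_norm _) _; rewrite lerDl.
wlog rho0 : rho hrho / 0 < rho.
  move=> W; apply: (W (`|rho| + 1)) => [g Gg|]; last exact: ltr_wpDl.
  by apply: le_trans (hrho g Gg) _; apply: le_trans (ler_norm _) _; rewrite lerDl.
apply: null_finite => eps e0.
(* The radius of the cubes provided by [slab_grid] is (K - 1) / N^2; the last
   summand makes room for open cubes. *)
pose K := 16 * C * rho ^+ 2 + d.+1%:R * (8 * C * rho) + 1.
have K0 : 0 < K.
  by rewrite ltr_wpDl// addr_ge0// !mulr_ge0// ?exprn_ge0 ltW// ltr0n.
pose N := (Num.truncn (K ^+ d.+1 / eps)).+1.
have NR : 0 < N%:R :> R by rewrite ltr0n.
have N0 : (0 < N)%N by [].
pose s := K / N%:R ^+ 2.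
have s0 : 0 < s by rewrite divr_gt0// exprn_gt0.
pose cell (k : {ffun 'I_d.+1 -> 'I_N}) : 'rV[R]_d.+1 :=
  \row_i (- rho + 2 * rho * (k i)%:R / N%:R).
pose h := 2 * rho / N%:R.
have h0 : 0 < h by rewrite divr_gt0// mulr_gt0.
have /choice[cen hcen] (k : {ffun 'I_d.+1 -> 'I_N}) :
    exists cen : {ffun 'I_d -> 'I_N} -> 'rV[R]_d.+1,
    forall g, G g -> `|g.1 - cell k| <= h -> exists m, ball (cen m) s g.2.
  have [[g [Gg gk]]|nG] := pselect (exists g, G g /\ `|g.1 - cell k| <= h); last first.
    by exists (fun=> 0) => g Gg gk; exfalso; apply: nG; exists g.
  have [l [[i li] l1 hlg]] := hl g Gg.
  have hh0 : 0 < 2 * h by apply: mulr_gt0.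
  have eta0 : 0 < C * (2 * h) by exact: mulr_gt0.
  have tau0 : 0 <= C * (2 * h) ^+ 2.
    by apply: mulr_ge0; [exact: ltW|apply: exprn_ge0; exact: ltW].
  have [cen hc] := slab_grid g.2 N0 eta0 tau0 li l1.
  exists cen => g' Gg' gk'.
  have gg : `|g'.1 - g.1| <= 2 * h.
    apply: le_trans (ler_distD (cell k) _ _) _; rewrite [X in _ + X]distrC.
    by apply: le_trans (lerD gk' gk) _; lra.
  have [||m hm] := hc g'.2.
  - apply: le_trans (hlip g g' Gg Gg') _; apply: ler_wpM2l => //; exact: ltW.
  - apply: le_trans (hlg g' Gg') _; apply: ler_wpM2l; first exact: ltW.
    by apply: lerXn2r; rewrite ?nnegrE// mulr_ge0// ltW.
  exists m; apply/rball_normE; apply: le_lt_trans hm _.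
  have -> : C * (2 * h) ^+ 2 + d.+1%:R * (2 * (C * (2 * h)) / N%:R) =
      (K - 1) / N%:R ^+ 2.
    by rewrite /K /h; move: (d.+1%:R : R) => D; field; rewrite gt_eqF.
  by rewrite /s ltr_pM2r ?invr_gt0 ?exprn_gt0// gtrBl.
exists [seq (cen k m, s) | k <- enum {ffun 'I_d.+1 -> 'I_N}, m <- enum {ffun 'I_d -> 'I_N}].
split.
- by move=> p /allpairsP[[k m] [_ _ ->]].
- move=> _ [g Gg <-].
  have /choice[k hk] i : exists k : 'I_N,
      `|g.1 ord0 i - (- rho + 2 * rho * k%:R / N%:R)| <= 2 * rho / N%:R.
    by apply: grid_approx => //; apply: le_trans (hrho g Gg); exact: coord_le_norm.
  have [|m hm] := hcen (finfun k) g Gg.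
    apply: norm_le_coord => [|i]; first exact: ltW.
    by rewrite !mxE ffunE; exact: hk.
  exists (cen (finfun k) m, s) => //.
  by apply/allpairsP; exists (finfun k, m); split; rewrite ?mem_enum.
- rewrite (@cost_const _ s); last by move=> p /allpairsP[[k m] [_ _ ->]].
  rewrite size_allpairs -!cardE !card_ffun !card_ord natrM !natrX /s exprMn exprVn.
  rewrite [leLHS](_ : _ = K ^+ d.+1 / N%:R); last first.
    rewrite -exprM mulnC exprM expr2 !exprS.
    have : N%:R ^+ d != 0 :> R by rewrite expf_neq0// gt_eqF.
    have := lt0r_neq0 NR.
    by move: (N%:R : R) (N%:R ^+ d : R) (K ^+ d) => a b c a0 b0; field; rewrite a0 b0.
  rewrite ler_pdivrMr// mulrC -ler_pdivrMr//; apply/ltW; exact: truncnS_gt.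
Qed.

End thin.

Section lindelof.
Context {R : realType} {d : nat} (T : topologicalType).

(** Countably many members b of a basis such that A meets b in a set with null image
    cover A; they are indexed through an injection of the basis into nat. *)
Lemma null_lindelof (v : T -> 'rV[R]_d) (A : set T) : @second_countable T ->
  (forall p, A p -> exists2 U, nbhs p U & null_set (v @` (A `&` U))) ->
  null_set (v @` A).
Proof.
move=> [B cB [oB bB]] h.
pose good (b : set T) := B b /\ null_set (v @` (A `&` b)).
have [n nB] : exists n : set T -> nat, set_inj B n.
  by have /pcard_leTP/unsquash f := cB; exists f; exact: 'inj_f.
apply: (@null_subset _ _ _ (\bigcup_k
   [set y | exists b, [/\ good b, n b = k & (v @` (A `&` b)) y]])).
  move=> _ [p Ap <-]; have [U pU nU] := h p Ap.
  have [b [Bb bp] bU] := bB p U pU.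
  exists (n b) => //; exists b; split => //; last by exists p.
  split => //; apply: null_subset nU.
  by move=> _ [q [Aq bq] <-]; exists q => //; split => //; exact: bU.
apply: null_bigcup => k.
have [[b [gb nbk]]|nb] := pselect (exists b, good b /\ n b = k).
  apply: null_subset gb.2 => y [b' [gb' nb' hy]].
  by rewrite (nB b b') ?inE//; [exact: gb.1|exact: gb'.1|rewrite nbk].
apply: null_subset (@null_set0 R d) => y [b [gb nbk _]].
by apply: nb; exists b.
Qed.

End lindelof.

(** * Critical values *)

Section critical_values.
Context {R : realType}.

(** An explicit lower bound, the inverse of 1 plus the sum of inverses, also covers
    the empty family. *)
Lemma positive_lower_bound (I : finType) (rho : I -> R) :
  (forall i, 0 < rho i) -> exists2 r, 0 < r & forall i, r <= rho i.
Proof.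
move=> h; pose S := 1 + \sum_i (rho i)^-1.
have S0 : 0 < S.
  by rewrite ltr_pwDl// sumr_ge0// => i _; rewrite invr_ge0 ltW.
exists S^-1; first by rewrite invr_gt0.
move=> i; rewrite -[rho i]invrK lef_pV2 ?posrE ?invr_gt0//.
rewrite /S (bigD1 i)//= addrCA lerDl addr_ge0// sumr_ge0// => j _.
by rewrite invr_ge0 ltW.
Qed.

Lemma Ck_dbound d k (f : 'rV[R]_d -> R) x r : 0 < r -> Ck k (ball x r) f ->
  exists rho B, [/\ 0 < rho, 0 <= B & dbound k (ball x rho) (fun=> B) f].
Proof.
move=> r0; elim: k f => [|k IH] f cf.
  have h : {for x, continuous f}.
    by apply: differentiable_continuous; apply: (Ck_diff cf); exact: ballxx.
  have [rho rho0 hrho] := cvg_rball (continuous_near_le h).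
  exists (Num.min r rho), (1 + `|f x|); split.
  - by rewrite lt_min r0.
  - exact: addr_ge0.
  - split => // y yb; split; last by apply: hrho; apply: le_ball yb; rewrite ge_min lexx orbT.
    by apply: (Ck_diff cf); apply: le_ball yb; rewrite ge_min lexx.
have /CkS[df hf] := cf.
have h : {for x, continuous f}.
  by apply: differentiable_continuous; apply: (Ck_diff cf); exact: ballxx.
have [rho0 rho00 hrho0] := cvg_rball (continuous_near_le h).
have /choice[rho hrho] i := IH _ (hf i).
have /choice[B hB] := hrho.
have [s s0 hs] := @positive_lower_bound _ rho (fun i => let: And3 h _ _ := hB i in h).
pose m := Num.min (Num.min r rho0) s.
pose BB := 1 + `|f x| + \sum_i B i.
have sB : 0 <= \sum_i B i by apply: sumr_ge0 => i _; have [] := hB i.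
exists m, BB; split.
- by rewrite !lt_min r0 rho00.
- by rewrite addr_ge0.
apply/dboundS; split => [y ym|i].
  split; first by apply: df; apply: le_ball ym; rewrite !ge_min lexx.
  apply: (@le_trans _ _ (1 + `|f x|)); last by rewrite lerDl.
  by apply: hrho0; apply: le_ball ym; rewrite !ge_min lexx orbT.
have [_ _ hd] := hB i; apply: dbound_mono hd.
  by move=> y; apply: le_ball; rewrite /m ge_min hs orbT.
move=> _; rewrite /BB (bigD1 i)//= addrCA lerDl addr_ge0// ?addr_ge0//.
by apply: sumr_ge0 => j _; have [] := hB j.
Qed.

Definition gradient_mx d (w : 'rV[R]_d.+1 -> R) (v : 'rV[R]_d.+1 -> 'rV[R]_d)
    (q : 'rV[R]_d.+1) : 'M[R]_d.+1 :=
  \matrix_(i, c) (if unlift ord0 c is Some j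
                  then dpartial i (fun y => v y ord0 j) q else dpartial i w q).

(** A linear relation between the differentials cannot involve that of w only, since
    it is nonzero; so it can be normalized by the coefficients on v. *)
Lemma singular_combination d (w : 'rV[R]_d.+1 -> R) (v : 'rV[R]_d.+1 -> 'rV[R]_d) q i :
  \det (gradient_mx w v q) = 0 -> dpartial i w q != 0 ->
  exists (a : R) (l : 'rV[R]_d), [/\ exists j, `|l ord0 j| = 1, `|l| <= 1 &
    forall i', a * dpartial i' w q +
      \sum_j l ord0 j * dpartial i' (fun y => v y ord0 j) q = 0].
Proof.
move=> /eqP; rewrite -det_tr => /det0P[z z0 zA] wi.
have hz i' : z ord0 ord0 * dpartial i' w q +
    \sum_j z ord0 (lift ord0 j) * dpartial i' (fun y => v y ord0 j) q = 0.
  have := congr1 (fun M : 'rV[R]__ => M ord0 i') zA.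
  rewrite !mxE big_ord_recl/= !mxE unlift_none => E; rewrite -[RHS]E.
  by congr (_ + _); apply: eq_bigr => j _; rewrite !mxE liftK.
pose l0 : 'rV[R]_d := \row_j z ord0 (lift ord0 j).
have l00 : `|l0| != 0.
  apply: contra_neq z0 => /eqP; rewrite normr_eq0 => /eqP l00.
  have zl j : z ord0 (lift ord0 j) = 0.
    by have := congr1 (fun M : 'rV[R]__ => M ord0 j) l00; rewrite !mxE.
  apply/rowP => c; rewrite mxE; case: (unliftP ord0 c) => [j ->|->]; first exact: zl.
  have := hz i; rewrite big1 => [|j _]; last by rewrite zl mul0r.
  by rewrite addr0 => /eqP; rewrite mulf_eq0 (negbTE wi) orbF => /eqP.
have n0 : 0 < `|l0| by rewrite lt_neqAle eq_sym l00 normr_ge0.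
exists (z ord0 ord0 / `|l0|), (`|l0|^-1 *: l0); split.
- have [[i0 j] hj] := mx_norm_neq0 l00.
  exists j; rewrite mxE normrM normfV normr_id [X in _^-1 * X](_ : _ = `|l0|).
    by rewrite mulVf.
  by transitivity (mx_norm l0) => //; rewrite hj /= (ord1 i0).
- by rewrite normrZ normfV normr_id mulVf.
- move=> i'; apply: (mulfI l00); rewrite mulr0 -[RHS](hz i') mulrDr mulr_sumr.
  congr (_ + _); first by field.
  by apply: eq_bigr => j _; rewrite !mxE; field.
Qed.

(** Near p, the zero set of w is a Lipschitz graph over the coordinates other than
    i. If a dw + l . dv = 0 at q, then l . v has the same differential as - a w,
    and w vanishes at all points of D; so l . (v q' - v q) is O(|q' - q|^2) and
    [null_thin] applies, the parameters being the other coordinates. *)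
Lemma null_critical_values d (w : 'rV[R]_d.+1 -> R) (v : 'rV[R]_d.+1 -> 'rV[R]_d) p i r
    (D : set 'rV[R]_d.+1) : 0 < r -> Ck 2 (ball p r) w ->
  (forall j, Ck 2 (ball p r) (fun q => v q ord0 j)) -> dpartial i w p != 0 ->
  (forall q, D q -> w q = 0 /\ \det (gradient_mx w v q) = 0) ->
  exists2 rho, 0 < rho & null_set (v @` (D `&` ball p rho)).
Proof.
move=> r0 cw cv wi hD.
have [rw [Bw [rw0 Bw0 dw]]] := Ck_dbound r0 cw.
have /choice[rv hrv] j := Ck_dbound r0 (cv j).
have /choice[Bv hBv] := hrv.
have [rv' rv'0 hrv'] := @positive_lower_bound _ rv (fun j => let: And3 h _ _ := hBv j in h).
pose kappa := `|dpartial i w p| / 2.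
have k0 : 0 < kappa by rewrite divr_gt0// normr_gt0.
have [rk rk0 hrk] : exists2 rk, 0 < rk & forall q, ball p rk q -> kappa <= `|dpartial i w q|.
  apply: cvg_rball.
  have ci : {for p, continuous (dpartial i w)}.
    apply: differentiable_continuous.
    by apply: (Ck_diff (Ck_partial i cw)); exact: ballxx.
  have /cvgrPdist_lt/(_ _ k0) := ci; apply: filterS => q hq.
  have := ler_normD (dpartial i w p - dpartial i w q) (dpartial i w q).
  by rewrite subrK; move: hq; rewrite /kappa; lra.
pose rho := Num.min (Num.min rw rv') rk.
have rho0 : 0 < rho by rewrite !lt_min rw0 rv'0.
have sB : 0 <= \sum_j Bv j by apply: sumr_ge0 => j _; have [] := hBv j.
pose B := Bw + \sum_j Bv j.
have B0 : 0 <= B by exact: addr_ge0.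
have dw' : dbound 2 (ball p rho) (fun=> B) w.
  apply: dbound_mono dw => [y|_]; last by rewrite lerDl.
  by apply: le_ball; rewrite !ge_min lexx.
have dv' j : dbound 2 (ball p rho) (fun=> B) (fun q => v q ord0 j).
  have [_ _] := hBv j; apply: dbound_mono => [y|_].
    by apply: le_ball; rewrite /rho !ge_min hrv' orbT.
  rewrite /B (bigD1 j)//= addrCA lerDl addr_ge0// sumr_ge0// => j' _.
  by have [] := hBv j'.
have kap q : ball p rho q -> kappa <= `|dpartial i w q|.
  by move=> qb; apply: hrk; apply: le_ball qb; rewrite ge_min lexx orbT.
exists rho => //.
pose a (q : 'rV[R]_d.+1) : 'rV[R]_d := \row_j q ord0 (lift i j).
pose G := [set g : 'rV[R]_d * 'rV[R]_d | exists q, [/\ D q, ball p rho q & g = (a q, v q)]].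
have GE : v @` (D `&` ball p rho) `<=` [set g.2 | g in G].
  by move=> _ [q [Dq qb] <-]; exists (a q, v q) => //; exists q.
apply: null_subset GE _.
pose c := d%:R * B / kappa.
have c0 : 0 <= c by rewrite divr_ge0 ?mulr_ge0// ltW.
(* The mean value theorem for w, which vanishes at q and at q', bounds the
   increment of the coordinate i by those of the other coordinates. *)
have graph q q' : D q -> D q' -> ball p rho q -> ball p rho q' ->
    `|q' - q| <= (1 + c) * `|a q' - a q|.
  move=> Dq Dq' qb qb'.
  have /dboundS[dw1 dw2] := dw'.
  have [t /andP[t0 t1]] := mvt_ball (fun y hy => (dw1 y hy).1) qb qb'.
  rewrite (hD q Dq).1 (hD q' Dq').1 subrr; set xi := q + _ => E.
  have xib : ball p rho xi by exact: ball_segment.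
  have aj j : (q' - q) ord0 (lift i j) = (a q' - a q) ord0 j by rewrite !mxE.
  apply: norm_le_coord => [|j]; first by rewrite mulr_ge0// addr_ge0.
  case: (unliftP i j) => [j' ->|->].
    rewrite aj; apply: le_trans (coord_le_norm _ _) _.
    by rewrite ler_peMl// lerDl.
  suff h : `|(q' - q) ord0 i| <= c * `|a q' - a q|.
    by apply: le_trans h _; rewrite ler_wpM2r// lerDr.
  rewrite /c mulrAC ler_pdivlMr//.
  apply: (@le_trans _ _ (`|(q' - q) ord0 i| * `|dpartial i w xi|)).
    by rewrite ler_wpM2l// kap.
  move: E => /esym; rewrite (bigD1_ord i)//= => /eqP; rewrite addr_eq0 => /eqP E.
  rewrite -normrM E normrN.
  under eq_bigr do rewrite aj.
  by apply: sum_coord_le => j'; have [] := dbound0 (dw2 (lift i j')) xib.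
pose D2 := d.+1%:R * (d.+1%:R * B).
have D20 : 0 <= D2 by rewrite !mulr_ge0.
(* The first summand is the quadratic constant in the direction l, the second one
   the Lipschitz constant of v along the graph. *)
pose C := ((c + d%:R) * D2 * (1 + c) ^+ 2) + d.+1%:R * B * (1 + c).
have C1 : 0 <= (c + d%:R) * D2 * (1 + c) ^+ 2.
  by rewrite !mulr_ge0 ?exprn_ge0 ?addr_ge0.
have C2 : 0 <= d.+1%:R * B * (1 + c) by rewrite !mulr_ge0 ?addr_ge0.
apply: (@null_thin _ _ _ (`|p| + rho) C).
- move=> _ [q [_ qb ->]] /=; apply: norm_le_coord => [|j]; first by rewrite addr_ge0// ltW.
  rewrite mxE; apply: le_trans (coord_le_norm _ _) _.
  rewrite -(subrK p q) addrC; apply: le_trans (ler_normD _ _) _.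
  by rewrite lerD2l; apply/ltW/rball_normE.
- move=> _ [q [Dq qb ->]] /=.
  have wq : dpartial i w q != 0 by rewrite -normr_gt0; apply: lt_le_trans (kap q qb).
  have [al [l [hj l1 hl]]] := singular_combination (hD q Dq).2 wq.
  exists l; split => // _ [q' [Dq' qb' ->]] /=.
  pose T f := f q' - f q - \sum_i0 (q' - q) ord0 i0 * dpartial i0 f q : R.
  have tw : `|T w| <= D2 * `|q' - q| ^+ 2 by exact: (taylor2_ball dw' qb qb').
  have tv j : `|T (fun q => v q ord0 j)| <= D2 * `|q' - q| ^+ 2.
    by exact: (taylor2_ball (dv' j) qb qb').
  have alc : `|al| <= c.
    rewrite /c ler_pdivlMr//.
    apply: (@le_trans _ _ (`|al| * `|dpartial i w q|)); first by rewrite ler_wpM2l// kap.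
    have := hl i => /eqP; rewrite addr_eq0 => /eqP E; rewrite -normrM E normrN.
    apply: (@le_trans _ _ (d%:R * B * `|l|)); last first.
      by rewrite -[leRHS]mulr1 ler_wpM2l// mulr_ge0.
    apply: sum_coord_le => j; have /dboundS[_ /(_ i) h] := dv' j.
    by have [] := dbound0 h qb.
  have -> : \sum_j l ord0 j * (v q' - v q) ord0 j =
      al * T w + \sum_j l ord0 j * T (fun q => v q ord0 j).
    rewrite /T (hD q Dq).1 (hD q' Dq').1 subrr sub0r mulrN.
    under [X in _ = _ + X]eq_bigr do rewrite mulrBr.
    rewrite sumrB addrCA -[LHS]addr0; congr (_ + _).
      by apply: eq_bigr => j _; rewrite !mxE.
    rewrite -opprD; apply/esym/eqP; rewrite oppr_eq0; apply/eqP.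
    under [X in _ + X = 0]eq_bigr do rewrite mulr_sumr.
    rewrite exchange_big/= mulr_sumr -big_split/= big1// => i' _.
    rewrite [X in _ + X](_ : _ = (q' - q) ord0 i' *
      \sum_j l ord0 j * dpartial i' (fun y => v y ord0 j) q); last first.
      by rewrite mulr_sumr; apply: eq_bigr => j _; rewrite mulrCA.
    by rewrite mulrCA -mulrDr hl mulr0.
  apply: (@le_trans _ _ ((c + d%:R) * D2 * `|q' - q| ^+ 2)).
    rewrite mulrDl mulrDl; apply: le_trans (ler_normD _ _) _; apply: lerD.
      by rewrite normrM -mulrA; apply: ler_pM.
    apply: le_trans (ler_norm_sum _ _ _) _.
    apply: (@le_trans _ _ (\sum_(j < d) D2 * `|q' - q| ^+ 2)).
      apply: ler_sum => j _; rewrite normrM -[leRHS]mul1r; apply: ler_pM => //.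
      by apply: le_trans l1; exact: coord_le_norm.
    by rewrite sumr_const card_ord -[X in X <= _]mulr_natl mulrA.
  apply: (@le_trans _ _ ((c + d%:R) * D2 * (1 + c) ^+ 2 * `|a q' - a q| ^+ 2)).
    rewrite -[leRHS]mulrA -exprMn; apply: ler_wpM2l; first by rewrite mulr_ge0// addr_ge0.
    by apply: lerXn2r; rewrite ?nnegrE ?mulr_ge0 ?addr_ge0//; exact: graph.
  by apply: ler_wpM2r; [exact: exprn_ge0|rewrite lerDl].
- move=> _ _ [q [Dq qb ->]] [q' [Dq' qb' ->]] /=.
  apply: (@le_trans _ _ (d.+1%:R * B * (1 + c) * `|a q' - a q|)); last first.
    by apply: ler_wpM2r => //; rewrite lerDr.
  apply: (@le_trans _ _ (d.+1%:R * B * `|q' - q|)); last first.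
    by rewrite -[leRHS]mulrA; apply: ler_wpM2l; [exact: mulr_ge0|exact: graph].
  apply: norm_le_coord => [|j]; first by rewrite !mulr_ge0.
  rewrite !mxE; have /dboundS[h1 h2] := dv' j.
  apply: (lipschitz_ball (fun y hy => (h1 y hy).1) _ qb qb') => y i' yb.
  by have [] := dbound0 (h2 i') yb.
Qed.

Lemma pderiv_lincomb d n (t : seq 'I_d) (U : set 'rV[R]_d) (c : 'I_n -> R)
    (g : 'I_n -> 'rV[R]_d -> R) f : open U ->
  (forall i, Ck (size t) U (g i)) ->
  (forall y, U y -> f y = \sum_i c i * g i y) ->
  forall y, U y -> pderiv t f y = \sum_i c i * pderiv t (g i) y.
Proof.
move=> oU; elim: t f g => [|j t IH] f g //= cg fE.
apply: IH => [i|y Uy]; first by have /CkS[] := cg i.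
have dg i : differentiable (g i) y by have /CkS[h _] := cg i; exact: h.
rewrite (@dpartial_near _ _ _ f (\sum_i (c i \*: g i))); last first.
  apply: filterS (open_nbhs_nbhs (conj oU Uy)) => z Uz.
  by rewrite fE// fct_sumE.
rewrite /dpartial derive_sum.
  by apply: eq_bigr => i _; rewrite deriveZ//; exact: diff_derivable.
by move=> i; apply: derivableZ; exact: diff_derivable.
Qed.

Definition partials_mx d (Psi : 'rV[R]_d -> 'rV[R]_d) (q : 'rV[R]_d) : 'M[R]_d :=
  \matrix_(i, c) dpartial i (fun y => Psi y ord0 c) q.

Definition tail_row d (Psi : 'rV[R]_d.+1 -> 'rV[R]_d.+1) (q : 'rV[R]_d.+1) : 'rV[R]_d :=
  \row_j Psi q ord0 (lift ord0 j).

(** The cofactors along the first column do not see that column. *)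
Lemma cofactor_gradient d w (Psi : 'rV[R]_d.+1 -> 'rV[R]_d.+1) q i :
  cofactor (gradient_mx w (tail_row Psi) q) i ord0 = cofactor (partials_mx Psi q) i ord0.
Proof.
rewrite /cofactor; congr (_ * \det _); apply/matrixP => a b; rewrite !mxE liftK.
by congr (dpartial _ _ _); apply/funext => y; rewrite mxE.
Qed.

Lemma Ck_det d e k (U : set 'rV[R]_d) (A : 'rV[R]_d -> 'M[R]_e) : open U ->
  (forall i j, Ck k U (fun y => A y i j)) -> Ck k U (fun y => \det (A y)).
Proof.
move=> oU h; rewrite /determinant; apply: Ck_sum => // s _.
by apply: CkM => //; [exact: Ck_cst|exact: Ck_prod].
Qed.

Lemma Ck_partials_det d k (U : set 'rV[R]_d) (Psi : 'rV[R]_d -> 'rV[R]_d) : open U ->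
  (forall c, Ck k.+1 U (fun y => Psi y ord0 c)) ->
  Ck k U (fun y => \det (partials_mx Psi y)).
Proof.
move=> oU h; apply: Ck_det => // i j.
rewrite (_ : (fun y => _) = dpartial i (fun y => Psi y ord0 j)); first exact: Ck_partial.
by apply/funext => y; rewrite mxE.
Qed.

Lemma ab_partials_det d (U : set 'rV[R]_d) (Psi : 'rV[R]_d -> 'rV[R]_d) : open U ->
  (forall c, analytic_bounded U (fun y => Psi y ord0 c)) ->
  analytic_bounded U (fun y => \det (partials_mx Psi y)).
Proof.
move=> oU h; apply: ab_det => // i j.
rewrite (_ : (fun y => _) = dpartial i (fun y => Psi y ord0 j)); first exact: ab_partial.
by apply/funext => y; rewrite mxE.
Qed.

Definition smooth_at d (f : 'rV[R]_d -> R) x :=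
  forall k, exists2 r, 0 < r & Ck k (ball x r) f.

Lemma smooth_family d (I : finType) (f : I -> 'rV[R]_d -> R) x k :
  (forall i, smooth_at (f i) x) ->
  exists2 r, 0 < r & forall i, Ck k (ball x r) (f i).
Proof.
move=> h; have /choice[r hr] i : exists r, 0 < r /\ Ck k (ball x r) (f i).
  by have [r r0 hr] := h i k; exists r.
have [s s0 hs] := @positive_lower_bound _ r (fun i => (hr i).1).
exists s => // i; apply: Ck_sub (hr i).2 => y; exact: le_ball.
Qed.

(** Expand det d Psi along its first column as the sum of cof_i d_i u. Here u is
    O(|h|^(m+1)) with m the length of t, hence so is the determinant. Replacing
    cof_i by its value at q costs O(|h|) O(|h|^m). So the sum of cof_i(q) d_i u is
    O(|h|^(m+1)) and its derivative along t vanishes at q: this is the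
    determinant to be computed. *)
Lemma degenerate_at_minimal_order d (Psi : 'rV[R]_d.+1 -> 'rV[R]_d.+1) q (t : seq 'I_d.+1) C :
  let u y := Psi y ord0 ord0 in
  (forall c, smooth_at (fun y => Psi y ord0 c) q) ->
  (forall s, (size s <= size t)%N -> pderiv s u q = 0) ->
  (\forall y \near q, `|\det (partials_mx Psi y)| <= C * `|u y|) ->
  \det (gradient_mx (pderiv t u) (tail_row Psi) q) = 0.
Proof.
move=> u sm fl hdet.
have [r r0 hr] := smooth_family (size t).+2 sm.
have qr : ball q r q by exact: ballxx.
have oB : open (ball q r) by exact: ball_open.
have cu : Ck (size t).+2 (ball q r) u := hr ord0.
have [C1 C10 h1] : exists2 C1, 0 <= C1 & \forall y \near q, `|u y| <= C1 * `|y - q| ^+ (size t).+1.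
  by apply: (flat_bound r0) => [|s st]; [exact: Ck_pred|exact: fl].
have [C2 C20 h2] : exists2 C2, 0 <= C2 & \forall y \near q, forall i,
    `|dpartial i u y| <= C2 * `|y - q| ^+ size t.
  apply: (@uniform_constant _ _ _ (nbhs q) _ (fun i y => `|dpartial i u y|)
    (fun y => `|y - q| ^+ size t)) => [y|i]; first exact: exprn_ge0.
  have [||C2 _ hC2] := @flat_bound _ _ (size t) (dpartial i u) q r r0; last by exists C2.
    by apply/Ck_pred; exact: Ck_partial.
  by move=> s st; exact: (fl (i :: s)).
pose cof i y := cofactor (partials_mx Psi y) i ord0.
have ccof i : Ck 1 (ball q r) (cof i).
  apply: CkM => //; first exact: Ck_cst.
  apply: Ck_det => // a b.
  rewrite (_ : (fun y => _) = dpartial (lift i a) (fun y => Psi y ord0 (lift ord0 b))).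
    by apply: Ck_partial; exact: (Ck_leq (isT : 1 < (size t).+2)%N (hr _)).
  by apply/funext => y; rewrite !mxE.
have [C3 C30 h3] : exists2 C3, 0 <= C3 & \forall y \near q, forall i,
    `|cof i q - cof i y| <= C3 * `|y - q|.
  apply: (@uniform_constant _ _ _ (nbhs q) _ (fun i y => `|cof i q - cof i y|)
    (fun y => `|y - q|)) => // i.
  have [C3 [rho [_ rho0 _ h]]] := Ck1_lipschitz r0 (ccof i).
  exists C3; near=> y; rewrite distrC; apply: h; first exact: ballxx.
  by near: y; exact: nbhsx_ballx.
pose f y := \sum_i cof i q * dpartial i u y.
pose CC := `|C| * C1 + d.+1%:R * (C3 * C2).
have hf : \forall y \near q, `|f y| <= CC * `|y - q| ^+ (size t).+1.
  near=> y.
  have dE : \det (partials_mx Psi y) = \sum_i cof i y * dpartial i u y.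
    by rewrite (expand_det_col _ ord0); apply: eq_bigr => i _; rewrite mxE mulrC.
  have -> : f y = \det (partials_mx Psi y) + \sum_i (cof i q - cof i y) * dpartial i u y.
    by rewrite dE -big_split; apply: eq_bigr => i _ /=; rewrite mulrBl addrC subrK.
  rewrite /CC mulrDl; apply: le_trans (ler_normD _ _) _; apply: lerD.
    apply: (@le_trans _ _ (`|C| * `|u y|)).
      apply: (@le_trans _ _ (C * `|u y|)); first by near: y.
      by apply: ler_wpM2r => //; exact: ler_norm.
    by rewrite -mulrA; apply: ler_wpM2l => //; near: y.
  apply: le_trans (ler_norm_sum _ _ _) _.
  apply: (@le_trans _ _ (\sum_(i < d.+1) C3 * C2 * `|y - q| ^+ (size t).+1)).
    apply: ler_sum => i _; rewrite normrM exprS.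
    rewrite [leRHS](_ : _ = C3 * `|y - q| * (C2 * `|y - q| ^+ size t)); last by ring.
    have hc : `|cof i q - cof i y| <= C3 * `|y - q| by move: (i); near: y.
    have hd : `|dpartial i u y| <= C2 * `|y - q| ^+ size t by move: (i); near: y.
    exact: ler_pM.
  by rewrite sumr_const card_ord -[X in X <= _]mulr_natl mulrA.
have CC0 : 0 <= CC by rewrite addr_ge0 ?mulr_ge0.
have ct i : Ck (size t) (ball q r) (dpartial i u).
  by apply/Ck_pred; exact: Ck_partial.
have cf : Ck (size t) (ball q r) f.
  by apply: Ck_sum => // i _; apply: CkM => //; exact: Ck_cst.
have := flat_of_bound r0 CC0 (ltnSn _) cf hf.
rewrite (@pderiv_lincomb _ _ t (ball q r) (fun i => cof i q) (fun i => dpartial i u))// => E.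
rewrite (expand_det_col _ ord0) -[RHS]E; apply: eq_bigr => i _.
rewrite cofactor_gradient mulrC mxE unlift_none -pderiv_rcons.
by rewrite (@pderiv_rotate _ _ t i u q r)//; exact: Ck_pred.
Unshelve. all: by end_near. Qed.

(** The zeros of u of order m + 1, where m is the length of t, such that moreover
    the derivative of u along t has a nonzero partial derivative of index i. *)
Definition stratum d (Psi : 'rV[R]_d.+1 -> 'rV[R]_d.+1) (A : set 'rV[R]_d.+1)
    (t : seq 'I_d.+1) i : set 'rV[R]_d.+1 :=
  let u y := Psi y ord0 ord0 in
  [set q | [/\ A q, forall s, (size s <= size t)%N -> pderiv s u q = 0 &
     dpartial i (pderiv t u) q != 0]].

(** Take a nonvanishing derivative of minimal order, and split off its last index. *)
Lemma stratum_cover d (Psi : 'rV[R]_d.+1 -> 'rV[R]_d.+1) (A : set 'rV[R]_d.+1) q :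
  let u y := Psi y ord0 ord0 in
  A q -> u q = 0 -> (exists s, pderiv s u q != 0) -> exists t i, stratum Psi A t i q.
Proof.
move=> u Aq uq [s hs].
have [n] := ubnP (size s); elim: n s hs => // n IH s hs sn.
have [[s' [h1 h2]]|nex] :=
    pselect (exists s', (size s' < size s)%N /\ pderiv s' u q != 0).
  by apply: (IH s') => //; exact: leq_trans h1 _.
case/lastP: s hs sn nex => [|t i] hs sn nex; first by rewrite /= uq eqxx in hs.
exists t, i; split => //; last by rewrite -pderiv_rcons.
move=> s' hs'; apply/eqP; apply/negPn/negP => h; apply: nex.
by exists s'; rewrite size_rcons ltnS.
Qed.

Lemma stratum_null d (Psi : 'rV[R]_d.+1 -> 'rV[R]_d.+1) (A : set 'rV[R]_d.+1) t i p :
  let u y := Psi y ord0 ord0 in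
  (forall q, A q -> forall c, smooth_at (fun y => Psi y ord0 c) q) ->
  (forall q, A q -> exists C,
     \forall y \near q, `|\det (partials_mx Psi y)| <= C * `|u y|) ->
  stratum Psi A t i p ->
  exists2 rho, 0 < rho & null_set (tail_row Psi @` (stratum Psi A t i `&` ball p rho)).
Proof.
move=> u sm hdet [Ap hp ip].
have [r r0 hr] := smooth_family ((size t) + 2)%N (sm p Ap).
apply: (@null_critical_values d (pderiv t u) _ p i r) => //.
- by apply: Ck_pderiv; exact: hr.
- move=> j; rewrite (_ : (fun q => _) = (fun q => Psi q ord0 (lift ord0 j))).
    by apply: Ck_leq (hr _); rewrite leq_addl.
  by apply/funext => q; rewrite mxE.
- move=> q [Aq hq iq]; split; first exact: hq.
  have [C hC] := hdet q Aq.
  exact: (degenerate_at_minimal_order (sm q Aq) hq hC).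
Qed.

End critical_values.

(** * The top exterior power *)

Section wedge.
Context {R : realType}.

(** The factors are arranged as in the top exterior power of a vector and n copies
    of a bivector. *)
Lemma prod_pairs n (F : 'I_n.*2.+1 -> R) :
  \prod_i F i = F ord0 * \prod_(j < n) (F (inord j.*2.+1) * F (inord j.*2.+2)).
Proof.
have H m (f : nat -> R) :
    \prod_(i < m.*2.+1) f i = f 0%N * \prod_(j < m) (f j.*2.+1 * f j.*2.+2).
  elim: m => [|m IH]; first by rewrite big_ord_recl !big_ord0.
  by rewrite doubleS 2!big_ord_recr/= IH [in RHS]big_ord_recr/= !mulrA.
transitivity (\prod_(i < n.*2.+1) F (inord i)).
  by apply: eq_bigr => i _; rewrite inord_val.
rewrite (H n (fun k => F (inord k))); congr (F _ * _).
by apply: val_inj; rewrite /= inordK.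
Qed.

Lemma inord_odd n (j : 'I_n) : (inord j.*2.+1 : 'I_n.*2.+1) = j.*2.+1 :> nat.
Proof. by rewrite inordK// !ltnS ltn_double. Qed.

Lemma inord_even n (j : 'I_n) : (inord j.*2.+2 : 'I_n.*2.+1) = j.*2.+2 :> nat.
Proof. by rewrite inordK// ltnS -doubleS leq_double. Qed.

(** Rows v, e_b1, e_c1, ..., e_bn, e_cn for phi = ((b1, c1), ..., (bn, cn)). *)
Definition wedge_rows n (v : 'rV[R]_(n.*2.+1))
    (phi : {ffun 'I_n -> 'I_(n.*2.+1) * 'I_(n.*2.+1)}) : 'M[R]_(n.*2.+1) :=
  \matrix_(i < n.*2.+1) (if i == ord0 then v
    else if insub (i.-1)./2 is Some j
    then delta_mx ord0 (if odd i then (phi j).1 else (phi j).2) else 0).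

Lemma wedge_rows_prod n (v : 'rV[R]_(n.*2.+1)) phi (J : 'M[R]_(n.*2.+1)) (s : 'S_(n.*2.+1)) :
  \prod_i (wedge_rows v phi *m J) i (s i) =
  (v *m J) ord0 (s ord0) * \prod_(j < n) (J (phi j).1 (s (inord j.*2.+1)) *
     J (phi j).2 (s (inord j.*2.+2))).
Proof.
have entryE i k : (wedge_rows v phi *m J) i k = (row i (wedge_rows v phi) *m J) ord0 k.
  by rewrite -row_mul [RHS]mxE.
rewrite prod_pairs entryE rowK eqxx; congr (_ * _); apply: eq_bigr => j _.
have E (i : 'I_n.*2.+1) (b : bool) : i = (j.*2 + b).+1 :> nat ->
    forall k, (wedge_rows v phi *m J) i k = J (if b then (phi j).2 else (phi j).1) k.
  move=> iE k; rewrite entryE rowK ifN; last by rewrite -val_eqE /= iE.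
  rewrite iE /= addnC half_bit_double insubT// => lt_j.
  rewrite oddD odd_double addbF oddb.
  have -> : Sub (val j) lt_j = j :> 'I_n by exact: val_inj.
  by rewrite -rowE mxE; case: b {iE}.
by rewrite (E _ false) ?inord_odd ?addn0// (E _ true) ?inord_even ?addn1.
Qed.

(** Expand each bivector on the basis e_b (x) e_c. What remains is a linear
    combination of determinants with rows v, e_b, e_c, ... multiplied by J, from
    which det J can be factored out. *)
Lemma wedge_sum_push n (v : 'rV[R]_(n.*2.+1)) (P J : 'M[R]_(n.*2.+1)) :
  \sum_(s : 'S_(n.*2.+1)) (-1) ^+ s * (v *m J) ord0 (s ord0) *
    \prod_(j < n) (J^T *m P *m J) (s (inord j.*2.+1)) (s (inord j.*2.+2)) =
  \sum_(phi : {ffun 'I_n -> 'I_(n.*2.+1) * 'I_(n.*2.+1)})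
    (\prod_(j < n) P (phi j).1 (phi j).2) * \det (wedge_rows v phi *m J).
Proof.
under [RHS]eq_bigr do rewrite /determinant mulr_sumr.
rewrite exchange_big/=; apply: eq_bigr => s _.
have -> : \prod_(j < n) (J^T *m P *m J) (s (inord j.*2.+1)) (s (inord j.*2.+2)) =
    \sum_(phi : {ffun 'I_n -> 'I_(n.*2.+1) * 'I_(n.*2.+1)})
      \prod_(j < n) (P (phi j).1 (phi j).2 * (J (phi j).1 (s (inord j.*2.+1)) *
        J (phi j).2 (s (inord j.*2.+2)))).
  rewrite -(bigA_distr_bigA (fun (j : 'I_n) (p : 'I_(n.*2.+1) * 'I_(n.*2.+1)) =>
    P p.1 p.2 * (J p.1 (s (inord j.*2.+1)) * J p.2 (s (inord j.*2.+2))))).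
  apply: eq_bigr => j _; rewrite mxE.
  under [LHS]eq_bigr do rewrite mxE mulr_suml.
  rewrite exchange_big/= pair_big/=; apply: eq_bigr => p _.
  by rewrite mxE; ring.
rewrite mulr_sumr; apply: eq_bigr => phi _.
by rewrite wedge_rows_prod big_split/= mulrCA -!mulrA.
Qed.

Lemma wedge_top_push n (v : 'rV[R]_(n.*2.+1)) (P J : 'M[R]_(n.*2.+1)) :
  wedge_top (push_vector J v) (push_bivector J P) = \det J * wedge_top v P.
Proof.
rewrite /wedge_top /push_vector /push_bivector wedge_sum_push mulrCA.
congr (_ * _).
have := wedge_sum_push v P 1%:M.
rewrite trmx1 mul1mx !mulmx1 => ->; rewrite mulr_sumr; apply: eq_bigr => phi _.
rewrite mulmx1.
by rewrite det_mulmx [RHS]mulrCA [\det (wedge_rows _ _) * _]mulrC.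
Qed.

End wedge.

(** * Smooth functions in charts *)

Section smooth.
Context {R : realType}.

Lemma analytic_smooth d (f : 'rV[R]_d -> R) x : analytic_at f x -> smooth_at f x.
Proof.
by move=> /analytic_at_bounded[r r0 h] k; exists r => //; exact: ab_Ck.
Qed.

Lemma smooth_diff d (f : 'rV[R]_d -> R) x : smooth_at f x -> differentiable f x.
Proof. by move=> /(_ 0%N)[r r0 h]; apply: (Ck_diff h); exact: ballxx. Qed.

Lemma smooth_ext d (f g : 'rV[R]_d -> R) x : (\forall y \near x, f y = g y) ->
  smooth_at f x -> smooth_at g x.
Proof.
move=> fg sf k; have [r r0 h] := sf k; have [s s0 hs] := cvg_rball fg.
exists (Num.min r s); first by rewrite lt_min r0.
apply: (@Ck_ext _ _ _ _ f); first exact: ball_open.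
  by move=> y yb; apply: hs; apply: le_ball yb; rewrite ge_min lexx orbT.
by apply: Ck_sub h => y; apply: le_ball; rewrite ge_min lexx.
Qed.

Lemma smooth_comp d e (f : 'rV[R]_e -> R) (F : 'rV[R]_d -> 'rV[R]_e) x :
  (forall j, smooth_at (fun y => F y ord0 j) x) -> smooth_at f (F x) ->
  smooth_at (f \o F) x.
Proof.
move=> sF sf k; have [r r0 hr] := smooth_family k sF; have [s s0 hs] := sf k.
have cF : {for x, continuous F}.
  by apply: differentiable_continuous; apply: diff_row => j; exact: smooth_diff.
have [t t0 ht] : exists2 t, 0 < t & forall y, ball x t y -> ball (F x) s (F y).
  by apply: cvg_rball; apply: cF; exact: nbhsx_ballx.
exists (Num.min r t); first by rewrite lt_min r0.
apply: (@Ck_comp _ _ _ _ _ (ball (F x) s)) => //; first exact: ball_open.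
  by move=> y yb; apply: ht; apply: le_ball yb; rewrite ge_min lexx orbT.
by move=> j; apply: Ck_sub (hr j) => y; apply: le_ball; rewrite ge_min lexx.
Qed.

(** The top coefficient is a polynomial in the components. *)
Lemma smooth_wedge n d (E : 'rV[R]_d -> 'rV[R]_(n.*2.+1))
    (P : 'rV[R]_d -> 'M[R]_(n.*2.+1)) x :
  (forall i, smooth_at (fun y => E y ord0 i) x) ->
  (forall i j, smooth_at (fun y => P y i j) x) ->
  smooth_at (fun y => wedge_top (E y) (P y)) x.
Proof.
move=> sE sP k; have [r r0 hr] := smooth_family k sE.
have [s s0 hs] := @smooth_family _ _ ('I_n.*2.+1 * 'I_n.*2.+1)%type
  (fun ij y => P y ij.1 ij.2) x k (fun ij => sP ij.1 ij.2).
exists (Num.min r s); first by rewrite lt_min r0.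
have oB : open (ball x (Num.min r s)) by exact: ball_open.
rewrite /wedge_top; apply: CkM => //; first exact: Ck_cst.
apply: Ck_sum => // p _; apply: CkM => //.
  apply: CkM => //; first exact: Ck_cst.
  by apply: Ck_sub (hr _) => y; apply: le_ball; rewrite ge_min lexx.
apply: Ck_prod => // j _.
have := hs (p (inord j.*2.+1), p (inord j.*2.+2)).
by apply: Ck_sub => y; apply: le_ball; rewrite ge_min lexx orbT.
Qed.

Lemma smooth_continuous d (f : 'rV[R]_d -> R) x : smooth_at f x ->
  {for x, continuous f}.
Proof. by move=> /smooth_diff; exact: differentiable_continuous. Qed.

Lemma near_continuous d e (F : 'rV[R]_d -> 'rV[R]_e) x (P : set 'rV[R]_e) :
  {for x, continuous F} -> nbhs (F x) P -> \forall y \near x, P (F y).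
Proof. by move=> c; exact: c. Qed.

Lemma pderiv_near0 d (s : seq 'I_d) (f : 'rV[R]_d -> R) x :
  (\forall y \near x, f y = 0) -> pderiv s f x = 0.
Proof.
move=> /cvg_rball[r r0 h].
have H : forall y, ball x r y -> pderiv s f y = \sum_(i < 0) (0 : R) * pderiv s (fun=> 0) y.
  apply: (@pderiv_lincomb _ _ _ _ _ (fun=> 0) (fun _ _ => 0)).
  - exact: ball_open.
  - by case.
  - by move=> y /h ->; rewrite big_ord0.
by rewrite (H x) ?big_ord0//; exact: ballxx.
Qed.

Section chart.
Context {d : nat} {T : topologicalType} (a : chart R d T).

Lemma cinv_dom x : (cmap a @` cdom a) x -> cdom a (cinv a x).
Proof. by move=> [p ap <-]; rewrite cmapK. Qed.

Lemma cinvK x : (cmap a @` cdom a) x -> cmap a (cinv a x) = x.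
Proof. by move=> [p ap <-]; rewrite cmapK. Qed.

Lemma near_image p : cdom a p -> \forall y \near cmap a p, (cmap a @` cdom a) y.
Proof.
move=> ap; apply: open_nbhs_nbhs; split; first exact: cimg_open.
by exists p.
Qed.

Lemma near_cinv p (P : set T) : cdom a p -> nbhs p P ->
  \forall y \near cmap a p, P (cinv a y).
Proof.
move=> ap pP; have c := @cinv_continuous _ _ _ a (cmap a p) (ex_intro2 _ _ p ap erefl).
by apply: c; rewrite cmapK.
Qed.

Lemma near_cmap p (P : set 'rV[R]_d) : cdom a p -> nbhs (cmap a p) P ->
  \forall p' \near p, P (cmap a p').
Proof. by move=> ap; exact: (@cmap_continuous _ _ _ a p ap). Qed.

Lemma near_dom p : cdom a p -> nbhs p (cdom a).
Proof. by move=> ap; apply: open_nbhs_nbhs; split => //; exact: cdom_open. Qed.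

End chart.

End smooth.

(** * Jacobi structures in charts *)

Section jacobi_charts.
Context {R : realType} {n : nat} {M : analytic_manifold R n.*2.+1} (J : jacobi_structure M).

Definition top_coef (a : chart R n.*2.+1 M) (p : M) : R :=
  wedge_top (vcoord (jE J) a p) (bcoord (jpi J) a p).

Lemma singular_chart a p : matlas a -> cdom a p ->
  singular_locus J p <-> top_coef a p = 0.
Proof.
move=> aA ap; split => [[b [bA bp h]]|h]; last by exists a.
rewrite /top_coef (vcoord_change (jE J) bA aA bp ap).
by rewrite (bcoord_change (jpi J) bA aA bp ap) wedge_top_push h mulr0.
Qed.

Lemma top_coef_smooth a p : matlas a -> cdom a p ->
  smooth_at (fun x => top_coef a (cinv a x)) (cmap a p).
Proof.
move=> aA ap; apply: smooth_wedge => i.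
  by apply: analytic_smooth; exact: (vcoord_analytic (jE J) aA ap).
by move=> j; apply: analytic_smooth; exact: (bcoord_analytic (jpi J) aA ap).
Qed.

End jacobi_charts.

(** * Contact resolutions *)

Section resolution.
Context {R : realType} {n : nat} {M : analytic_manifold R n.*2.+1}
  {J : jacobi_structure M} (S : contact_resolution J).

Local Notation f := (@rmap _ _ _ _ S).
Local Notation K := (rjacobi S).

Lemma rmap_continuous (p : rsource S) (P : set M) : nbhs (f p) P ->
  \forall p' \near p, P (f p').
Proof. by have [[fc _] _] := rmap_jacobi S; exact: fc. Qed.

(** The relation E_M /\ pi_M^n = det(T phi) (E_S /\ pi_S^n) in charts, on a ball. *)
Lemma local_determinant a b (p : rsource S) : matlas a -> matlas b -> cdom a p ->
  cdom b (f p) -> exists2 r, 0 < r & [/\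
    forall y, ball (cmap a p) r y -> (cmap a @` cdom a) y /\ cdom b (f (cinv a y)),
    forall j, analytic_bounded (ball (cmap a p) r) (fun y => coord_rep a b f y ord0 j) &
    forall y, ball (cmap a p) r y -> top_coef J b (f (cinv a y)) =
      \det (partials_mx (coord_rep a b f) y) * top_coef K a (cinv a y)].
Proof.
move=> aA bA ap bfp; have [[fc fan] fjac] := rmap_jacobi S.
have /choice[rj hrj] j : exists r, 0 < r /\
    analytic_bounded (ball (cmap a p) r) (fun y => coord_rep a b f y ord0 j).
  by have [r r0 h] := analytic_at_bounded (fan a b p aA bA ap bfp ord0 j); exists r.
have [r1 r10 hr1] := @positive_lower_bound _ _ rj (fun j => (hrj j).1).
have [r2 r20 hr2] : exists2 r, 0 < r & forall y, ball (cmap a p) r y ->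
    (cmap a @` cdom a) y /\ cdom b (f (cinv a y)).
  apply: cvg_rball; apply: filterI; first exact: near_image.
  apply: (near_cinv (P := fun p' => cdom b (f p'))) => //.
  by apply: rmap_continuous; exact: near_dom.
have m1 : Num.min r1 r2 <= r1 by rewrite ge_min lexx.
have m2 : Num.min r1 r2 <= r2 by rewrite ge_min lexx orbT.
have ab j : analytic_bounded (ball (cmap a p) (Num.min r1 r2))
    (fun y => coord_rep a b f y ord0 j).
  by apply: ab_sub (hrj j).2 => y; apply: le_ball; exact: le_trans (hr1 j).
exists (Num.min r1 r2); first by rewrite lt_min r10.
split => // [y /(le_ball m2)/hr2//|y yb].
have [ya yb2] := hr2 y (le_ball m2 yb).
have ad := cinv_dom ya; have ak := cinvK ya.
rewrite /top_coef.
have [<- <-] : push_bivector (tangent_mx a b f (cinv a y)) (bcoord (jpi K) a (cinv a y)) =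
      bcoord (jpi J) b (f (cinv a y)) /\
    push_vector (tangent_mx a b f (cinv a y)) (vcoord (jE K) a (cinv a y)) =
      vcoord (jE J) b (f (cinv a y)) by exact: fjac.
rewrite wedge_top_push; congr (\det _ * _).
rewrite /tangent_mx ak; apply/matrixP => i j; rewrite jacobianE ?mxE//.
by move=> j'; apply: (Ck_diff (ab_Ck 0 (ab j'))).
Qed.

Lemma source_coef_neq0 a (p : rsource S) : matlas a -> cdom a p ->
  top_coef K a p != 0.
Proof. by move=> aA ap; exact: (@rcontact _ _ _ _ S p a Logic.I aA ap). Qed.

(** A flat analytic function vanishes nearby, and the zeros of the determinant are
    the points over the singular locus. *)
Lemma flat_determinant a b (p : rsource S) : matlas a -> matlas b -> cdom a p ->
  cdom b (f p) ->
  (forall s, pderiv s (fun y => \det (partials_mx (coord_rep a b f) y)) (cmap a p) = 0) ->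
  \forall p' \near p, singular_locus J (f p').
Proof.
move=> aA bA ap bfp fl.
have [r r0 [hr hab hdet]] := local_determinant aA bA ap bfp.
have oB : open (ball (cmap a p) r) by exact: ball_open.
have dab : analytic_bounded (ball (cmap a p) r)
    (fun y => \det (partials_mx (coord_rep a b f) y)).
  exact: ab_partials_det.
have z := ab_flat r0 dab fl.
have zr : \forall y \near cmap a p, ball (cmap a p) r y /\
    \det (partials_mx (coord_rep a b f) y) = 0.
  by apply: filterI => //; exact: nbhsx_ballx.
have np := near_cmap ap zr; near=> p'.
have [yb y0] : ball (cmap a p) r (cmap a p') /\
    \det (partials_mx (coord_rep a b f) (cmap a p')) = 0 by near: p'.
have ap' : cdom a p' by near: p'; exact: near_dom.
have := hdet _ yb; rewrite y0 mul0r cmapK// => E.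
by apply/(singular_chart J bA) => //; have [_] := hr _ yb; rewrite cmapK.
Unshelve. all: by end_near. Qed.

Lemma singular_flat a b (p : rsource S) : matlas a -> matlas b -> cdom a p ->
  cdom b (f p) -> (\forall p' \near p, singular_locus J (f p')) ->
  forall s, pderiv s (fun y => \det (partials_mx (coord_rep a b f) y)) (cmap a p) = 0.
Proof.
move=> aA bA ap bfp ns s; apply: pderiv_near0.
have [r r0 [hr hab hdet]] := local_determinant aA bA ap bfp.
have nb : \forall y \near cmap a p, ball (cmap a p) r y by exact: nbhsx_ballx.
have nc := near_cinv ap ns; near=> y.
have yb : ball (cmap a p) r y by near: y.
have [ya yb2] := hr y yb.
have sy : singular_locus J (f (cinv a y)) by near: y.
have := hdet y yb; have /(singular_chart J bA yb2) -> := sy.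
move=> /esym/eqP; rewrite mulf_eq0 => /orP[/eqP//|].
by rewrite (negbTE (source_coef_neq0 aA (cinv_dom ya))).
Unshelve. all: by end_near. Qed.

(** On points where phi is locally singular, all derivatives of the determinant
    vanish; by continuity they vanish at limits of such points, and
    [flat_determinant] applies there. *)
Lemma locally_singular_closed : closed [set p : rsource S |
  \forall p' \near p, singular_locus J (f p')].
Proof.
move=> p clp.
have [a aA ap] := matlas_cover p; have [b bA bfp] := matlas_cover (f p).
apply: (flat_determinant aA bA ap bfp) => s.
set dl := fun y => _.
have [r r0 [hr hab hdet]] := local_determinant aA bA ap bfp.
have oB : open (ball (cmap a p) r) by exact: ball_open.
have dab : analytic_bounded (ball (cmap a p) r) dl.
  exact: ab_partials_det.
have c : {for cmap a p, continuous (pderiv s dl)}.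
  apply: differentiable_continuous; apply: (@Ck_diff _ _ 0 (ball (cmap a p) r)).
    by apply: Ck_pderiv; exact: ab_Ck.
  exact: ballxx.
apply/eqP; rewrite -normr_le0; apply: le0_eps => e e0.
have /cvgrPdist_lt/(_ _ e0) ce := c.
have nU : \forall p' \near p, [/\ cdom a p', cdom b (f p') &
    `|pderiv s dl (cmap a p) - pderiv s dl (cmap a p')| < e].
  have h1 := near_dom ap.
  have h2 : \forall p' \near p, cdom b (f p').
    by apply: rmap_continuous; exact: near_dom.
  have h3 := near_cmap ap ce.
  by near=> p'; split; near: p'.
have [p' [Wp' [ap' bp']]] := clp _ nU.
rewrite (singular_flat aA bA ap' bp' Wp') subr0.
exact: ltW.
Unshelve. all: by end_near. Qed.

(** The set of points where phi is locally singular is open and closed, so it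
    contains the connected component of each of its points. *)
Lemma not_locally_singular (p : rsource S) : semi_connected S ->
  ~ \forall p' \near p, singular_locus J (f p').
Proof.
move=> sc Wp; apply: (sc p) => _ [p' Cp' <-].
pose W := [set p : rsource S | \forall p' \near p, singular_locus J (f p')].
pose C := connected_component [set: rsource S] p.
have Cc : connected C by exact: component_connected.
suff CW : C `&` W = C.
  have : (C `&` W) p' by rewrite CW.
  by move=> [_ /nbhs_singleton].
apply: Cc.
- by exists p; split => //; exact: connected_component_refl.
- exists W => //; rewrite openE => q Wq.
  exact: nbhs_interior.
- by exists W => //; exact: locally_singular_closed.
Qed.

End resolution.

(** * The hypersurface in a slice chart *)

Section slice.
Context {R : realType} {n : nat} {M : analytic_manifold R n.*2.+1}
  {J : jacobi_structure M} (S : contact_resolution J) (c : chart R n.*2.+1 M).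

Local Notation f := (@rmap _ _ _ _ S).

Definition compatible_chart := forall a, matlas a ->
  analytic_transition a c /\ analytic_transition c a.

Definition singular_hyperplane := forall q, cdom c q -> cmap c q ord0 ord0 = 0 ->
  singular_locus J q.

(** In the slice chart the coefficient is Lipschitz; compare its value at a point
    with that at the projection of this point on the hyperplane, where it is zero. *)
Lemma top_coef_hyperplane b q : compatible_chart -> singular_hyperplane ->
  matlas b -> cdom b q -> cdom c q -> cmap c q ord0 ord0 = 0 ->
  exists2 C, 0 <= C & \forall z \near cmap b q,
    `|top_coef J b (cinv b z)| <= C * `|coord_rep b c id z ord0 ord0|.
Proof.
move=> hc hN bA bq cq q0.
have [tbc tcb] := hc b bA.
pose x0 := cmap c q.
pose H := (fun z => top_coef J b (cinv b z)) \o coord_rep c b id.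
have sH : smooth_at H x0.
  apply: smooth_comp => [j|].
    by apply: analytic_smooth; exact: (tcb q cq bq ord0 j).
  by rewrite /coord_rep /x0 cmapK//; exact: top_coef_smooth.
have [r r0 hr] := sH 1%N.
have [C [rho [C0 rho0 rhor hlip]]] := Ck1_lipschitz r0 hr.
have [s s0 hs] : exists2 s, 0 < s & forall x, ball x0 s x ->
    (cmap c @` cdom c) x /\ cdom b (cinv c x).
  apply: cvg_rball; apply: filterI; first exact: near_image.
  by apply: near_cinv => //; exact: near_dom.
pose m := Num.min rho s.
have m0 : 0 < m by rewrite lt_min rho0.
exists C => //.
have stau j : smooth_at (fun z => coord_rep b c id z ord0 j) (cmap b q).
  by apply: analytic_smooth; exact: (tbc q bq cq ord0 j).
have ctau : {for cmap b q, continuous (coord_rep b c id)}.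
  by apply: differentiable_continuous; apply: diff_row => j; exact: smooth_diff.
have tauE : coord_rep b c id (cmap b q) = x0 by rewrite /coord_rep cmapK.
have n1 : \forall z \near cmap b q, ball x0 m (coord_rep b c id z).
  by apply: ctau; rewrite tauE; exact: nbhsx_ballx.
have n2 := near_image bq.
have n3 : \forall z \near cmap b q, cdom c (cinv b z).
  by apply: near_cinv => //; exact: near_dom.
near=> z.
have zb : ball x0 m (coord_rep b c id z) by near: z.
have zi : (cmap b @` cdom b) z by near: z.
have zc : cdom c (cinv b z) by near: z.
pose x := coord_rep b c id z; rewrite -/x in zb *.
have -> : top_coef J b (cinv b z) = H x.
  by rewrite /H /x /coord_rep /= (@cmapK _ _ _ c)// (@cinvK _ _ _ b).
pose x' : 'rV[R]_n.*2.+1 := \row_j (if j == ord0 then 0 else x ord0 j).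
have x'0 : x' ord0 ord0 = 0 by rewrite mxE eqxx.
have x'b : ball x0 m x'.
  apply/rball_normE; apply: le_lt_trans ((rball_normE _ _ _).1 zb).
  apply: norm_le_coord => // j; rewrite !mxE; case: eqP => [->|_].
    by rewrite -/x0 in q0; rewrite q0 subrr normr0.
  by apply: le_trans (coord_le_norm _ j); rewrite !mxE.
have [x'i x'bd] : (cmap c @` cdom c) x' /\ cdom b (cinv c x').
  by apply: hs; apply: le_ball x'b; rewrite ge_min lexx orbT.
have Hx' : H x' = 0.
  have cd := cinv_dom x'i.
  have sg : singular_locus J (cinv c x') by apply: hN; rewrite ?cinvK.
  rewrite /H /coord_rep /= cmapK//.
  exact/(singular_chart J bA x'bd).
have mr : m <= rho by rewrite ge_min lexx.
have := hlip x' x (le_ball mr x'b) (le_ball mr zb).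
rewrite Hx' subr0 => /le_trans; apply; apply: ler_wpM2l => //.
apply: norm_le_coord => // j; rewrite !mxE; case: eqP => [->|_].
  by rewrite subr0.
by rewrite subrr normr0.
Unshelve. all: by end_near. Qed.

(** The chart c need not belong to the atlas; its expressions are obtained from
    those in the chart b of the atlas. *)
Lemma rep_factor a b (p : rsource S) : matlas a -> matlas b -> cdom a p ->
  cdom b (f p) -> cdom c (f p) -> \forall y \near cmap a p,
    coord_rep a c f y = coord_rep b c id (coord_rep a b f y).
Proof.
move=> aA bA ap bp cp.
have h : \forall y \near cmap a p, cdom b (f (cinv a y)).
  apply: (near_cinv (P := fun p' => cdom b (f p'))) => //.
  by apply: rmap_continuous; exact: near_dom.
by apply: filterS h => y yb; rewrite /coord_rep cmapK.
Qed.

Lemma rep_smooth a (p : rsource S) : compatible_chart -> matlas a -> cdom a p ->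
  cdom c (f p) -> forall j, smooth_at (fun y => coord_rep a c f y ord0 j) (cmap a p).
Proof.
move=> hc aA ap cp j; have [b bA bp] := matlas_cover (f p).
have [tbc _] := hc b bA.
have [[_ fan] _] := rmap_jacobi S.
apply: (@smooth_ext _ _ ((fun z => coord_rep b c id z ord0 j) \o coord_rep a b f)).
  by apply: filterS (rep_factor aA bA ap bp cp) => y ->.
apply: smooth_comp => [j'|].
  by apply: analytic_smooth; exact: (fan a b p aA bA ap bp ord0 j').
rewrite {2}/coord_rep cmapK//.
by apply: analytic_smooth; exact: (tbc (f p) bp cp ord0 j).
Qed.

(** Divide the bound of [top_coef_hyperplane] by the coefficient on the source,
    which is bounded away from zero near p. *)
Lemma determinant_bound a b (p : rsource S) : compatible_chart -> singular_hyperplane ->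
  matlas a -> matlas b -> cdom a p -> cdom b (f p) -> cdom c (f p) ->
  cmap c (f p) ord0 ord0 = 0 ->
  exists2 C, 0 <= C & \forall y \near cmap a p,
    `|\det (partials_mx (coord_rep a b f) y)| <= C * `|coord_rep a c f y ord0 ord0|.
Proof.
move=> hc hN aA bA ap bp cp p0.
have [C C0 hC] := top_coef_hyperplane hc hN bA bp cp p0.
have [r r0 [hr hab hdet]] := local_determinant aA bA ap bp.
pose g y := top_coef (rjacobi S) a (cinv a y).
have gx : 0 < `|g (cmap a p)|.
  by rewrite normr_gt0 /g cmapK//; exact: source_coef_neq0.
have cg : {for cmap a p, continuous g}.
  by apply: smooth_continuous; exact: top_coef_smooth.
pose kappa := `|g (cmap a p)| / 2.
have k0 : 0 < kappa by rewrite divr_gt0.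
exists (C / kappa); first by rewrite divr_ge0// ltW.
have n1 : \forall y \near cmap a p, kappa <= `|g y|.
  have /cvgrPdist_lt/(_ _ k0) := cg; apply: filterS => y hy.
  have := ler_normD (g (cmap a p) - g y) (g y).
  by rewrite subrK; move: hy; rewrite /kappa; lra.
have cPhi : {for cmap a p, continuous (coord_rep a b f)}.
  apply: differentiable_continuous; apply: diff_row => j.
  by apply: (Ck_diff (ab_Ck 0 (hab j))); exact: ballxx.
have n2 : \forall y \near cmap a p,
    `|top_coef J b (cinv b (coord_rep a b f y))| <=
      C * `|coord_rep b c id (coord_rep a b f y) ord0 ord0|.
  apply: (near_continuous (P := fun z => `|top_coef J b (cinv b z)| <=
    C * `|coord_rep b c id z ord0 ord0|) cPhi).
  by rewrite {1}/coord_rep cmapK.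
have n3 := rep_factor aA bA ap bp cp.
near=> y.
have yb : ball (cmap a p) r y by near: y; exact: nbhsx_ballx.
have [_ yd] := hr y yb.
have y1 : kappa <= `|g y| by near: y.
have y2 : `|top_coef J b (cinv b (coord_rep a b f y))| <=
      C * `|coord_rep b c id (coord_rep a b f y) ord0 ord0| by near: y.
have -> : coord_rep a c f y = coord_rep b c id (coord_rep a b f y) by near: y.
rewrite mulrAC ler_pdivlMr//; apply: le_trans y2.
rewrite {2}/coord_rep cmapK// hdet// normrM.
exact: ler_wpM2l.
Unshelve. all: by end_near. Qed.

Lemma rep_determinant_bound a (p : rsource S) : compatible_chart -> singular_hyperplane ->
  matlas a -> cdom a p -> cdom c (f p) -> cmap c (f p) ord0 ord0 = 0 ->
  exists C, \forall y \near cmap a p,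
    `|\det (partials_mx (coord_rep a c f) y)| <= C * `|coord_rep a c f y ord0 ord0|.
Proof.
move=> hc hN aA ap cp p0; have [b bA bp] := matlas_cover (f p).
have [C C0 hC] := determinant_bound hc hN aA bA ap bp cp p0.
have [tbc _] := hc b bA.
have [[_ fan] _] := rmap_jacobi S.
have stau j : smooth_at (fun z => coord_rep b c id z ord0 j) (cmap b (f p)).
  by apply: analytic_smooth; exact: (tbc (f p) bp cp ord0 j).
have sPhi j : smooth_at (fun y => coord_rep a b f y ord0 j) (cmap a p).
  by apply: analytic_smooth; exact: (fan a b p aA bA ap bp ord0 j).
have cPhi : {for cmap a p, continuous (coord_rep a b f)}.
  by apply: differentiable_continuous; apply: diff_row => j; exact: smooth_diff.
have PhiE : coord_rep a b f (cmap a p) = cmap b (f p) by rewrite /coord_rep cmapK.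
have [r1 r10 h1] := smooth_family 1 stau.
have [r2 r20 h2] := smooth_family 0 sPhi.
pose D z := \det (partials_mx (coord_rep b c id) z).
have cD : {for cmap b (f p), continuous D}.
  apply: differentiable_continuous.
  apply: (@Ck_diff _ _ 0 (ball (cmap b (f p)) r1)); last exact: ballxx.
  by apply: Ck_partials_det; [exact: ball_open|exact: h1].
have n1 : \forall y \near cmap a p,
    `|D (coord_rep a b f y)| <= 1 + `|D (cmap b (f p))|.
  apply: (near_continuous (P := fun z => `|D z| <= 1 + `|D (cmap b (f p))|) cPhi).
  by rewrite PhiE; exact: continuous_near_le.
have n2 : \forall y \near cmap a p, ball (cmap b (f p)) r1 (coord_rep a b f y).
  by apply: cPhi; rewrite PhiE; exact: nbhsx_ballx.
have [s s0 hs] := cvg_rball (rep_factor aA bA ap bp cp).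
exists (C * (1 + `|D (cmap b (f p))|)).
near=> y.
have ys : ball (cmap a p) s y by near: y; exact: nbhsx_ballx.
have y2 : ball (cmap a p) r2 y by near: y; exact: nbhsx_ballx.
have y1 : ball (cmap b (f p)) r1 (coord_rep a b f y) by near: y.
have yD : `|D (coord_rep a b f y)| <= 1 + `|D (cmap b (f p))| by near: y.
have yC : `|\det (partials_mx (coord_rep a b f) y)| <=
    C * `|coord_rep a c f y ord0 ord0| by near: y.
have -> : partials_mx (coord_rep a c f) y =
    partials_mx (coord_rep a b f) y *m partials_mx (coord_rep b c id) (coord_rep a b f y).
  apply/matrixP => i j; rewrite !mxE.
  rewrite (@dpartial_near _ _ _ _
    ((fun z => coord_rep b c id z ord0 j) \o coord_rep a b f)).
    rewrite dpartial_comp; last 2 first.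
    - by move=> j'; exact: Ck_diff (h2 j') y2.
    - exact: Ck_diff (h1 j) y1.
    by apply: eq_bigr => k _; rewrite !mxE.
  have oB : open (ball (cmap a p) s) by exact: ball_open.
  by apply: filterS (open_nbhs_nbhs (conj oB ys)) => z /hs /= ->.
rewrite det_mulmx normrM -mulrA [_ * `|coord_rep _ _ _ _ _ _|]mulrC mulrA.
exact: ler_pM.
Unshelve. all: by end_near. Qed.

(** If u were flat, so would be the determinant, by [determinant_bound]. *)
Lemma rep_not_flat a (p : rsource S) : semi_connected S ->
  compatible_chart -> singular_hyperplane ->
  matlas a -> cdom a p -> cdom c (f p) -> cmap c (f p) ord0 ord0 = 0 ->
  exists s, pderiv s (fun y => coord_rep a c f y ord0 ord0) (cmap a p) != 0.
Proof.
move=> sc hc hN aA ap cp p0; apply: contrapT => nex.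
have fl s : pderiv s (fun y => coord_rep a c f y ord0 ord0) (cmap a p) = 0.
  by apply/eqP; apply: contrapT => /negP h; apply: nex; exists s.
have [b bA bp] := matlas_cover (f p).
apply: (not_locally_singular (p := p) sc).
apply: (flat_determinant aA bA ap bp) => s.
have [C C0 hC] := determinant_bound hc hN aA bA ap bp cp p0.
have [[_ fan] _] := rmap_jacobi S.
have [r r0 [hr hab hdet]] := local_determinant aA bA ap bp.
have [r' r'0 hr'] := rep_smooth hc aA ap cp ord0 (size s).+1.
have [C1 C10 hC1] := flat_bound r'0 hr' (fun s _ => fl s).
apply: (@flat_of_bound _ _ (size s).+1 s _ _ r (C * C1)) => //.
- exact: mulr_ge0.
- by apply: Ck_partials_det => [|j]; [exact: ball_open|exact: ab_Ck].
- near=> y; apply: le_trans (_ : C * `|coord_rep a c f y ord0 ord0| <= _).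
    by near: y.
  by rewrite -mulrA; apply: ler_wpM2l => //; near: y.
Unshelve. all: by end_near. Qed.

(** Second countability reduces the claim first to the domain of one chart, which
    is covered by countably many strata, then to a neighborhood of a point of one
    stratum, where [stratum_null] applies. *)
Lemma slice_image_null : semi_connected S -> compatible_chart -> singular_hyperplane ->
  null_set ((fun p => \row_j cmap c (f p) ord0 (lift ord0 j) : 'rV[R]_n.*2) @`
    [set p | cdom c (f p) /\ cmap c (f p) ord0 ord0 = 0]).
Proof.
move=> sc hc hN; set v := (X in null_set (X @` _)); set Z := [set p | _].
have sec := @msecond_countable _ _ (rsource S).
apply: null_lindelof => // p Zp.
have [a aA ap] := matlas_cover p.
exists (cdom a); first exact: near_dom.
pose Psi := coord_rep a c f.
pose A := cmap a @` (Z `&` cdom a).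
have vE p' : cdom a p' -> v p' = tail_row Psi (cmap a p').
  by move=> ap'; apply/rowP => j; rewrite !mxE /Psi /coord_rep cmapK.
pose I := (seq 'I_n.*2.+1 * 'I_n.*2.+1)%type.
pose E (ti : I) := [set p' | cdom a p' /\ stratum Psi A ti.1 ti.2 (cmap a p')].
apply: (@null_subset _ _ _ (\bigcup_(ti in [set: I]) (v @` E ti))).
  move=> _ [p' [Zp' ap'] <-].
  have Ax : A (cmap a p') by exists p'.
  have u0 : Psi (cmap a p') ord0 ord0 = 0 by rewrite /Psi /coord_rep cmapK//; exact: Zp'.2.
  have [s hs] := rep_not_flat sc hc hN aA ap' Zp'.1 Zp'.2.
  have [t [i ti]] := stratum_cover Ax u0 (ex_intro _ s hs).
  by exists (t, i) => //; exists p'.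
apply: null_countable_union => -[t i] _.
apply: null_lindelof => // p' [ap' sp'].
have smA q : A q -> forall j, smooth_at (fun y => Psi y ord0 j) q.
  by move=> [p'' [Zp'' ap''] <-]; exact: (rep_smooth hc aA ap'' Zp''.1).
have bdA q : A q -> exists C, \forall y \near q,
    `|\det (partials_mx Psi y)| <= C * `|Psi y ord0 ord0|.
  by move=> [p'' [Zp'' ap''] <-]; exact: (rep_determinant_bound hc hN aA ap'' Zp''.1 Zp''.2).
have [rho rho0 hrho] := stratum_null smA bdA sp'.
exists [set p'' | ball (cmap a p') rho (cmap a p'')].
  by apply: near_cmap => //; exact: nbhsx_ballx.
apply: null_subset hrho => _ [p'' [[ap'' sp''] bp''] <-].
by exists (cmap a p''); rewrite -?vE.
Qed.

End slice.

Theorem theorem4p3 (R : realType) (n : nat)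
    (M : analytic_manifold R n.*2.+1) (J : jacobi_structure M)
    (hcontact : exists U : set M, [/\ open U, dense U & contact_on J U])
    (hsing : exists N : set M, submanifold 1 N /\ N `<=` singular_locus J) :
  ~ exists S : contact_resolution J, semi_connected S.
Proof.
move=> [S sc]; have [N [[[q Nq] _ slice] Nsing]] := hsing.
have [c [cq hc hN]] := slice q Nq.
have N0 q' : cdom c q' -> cmap c q' ord0 ord0 = 0 -> N q'.
  move=> cq' q0; apply/(hN q' cq') => i; rewrite ltnS leqn0 => /eqP i0.
  by rewrite (_ : i = ord0)//; exact: val_inj.
have hyp : @singular_hyperplane _ _ _ J c by move=> q' cq' /(N0 q' cq'); exact: Nsing.
have qz : cmap c q ord0 ord0 = 0 by exact: ((hN q cq).1 Nq).
have [rho rho0 hrho] := cvg_rball (near_image cq).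
pose y0 : 'rV[R]_n.*2 := \row_j cmap c q ord0 (lift ord0 j).
apply: (@ball_not_null _ _ y0 rho rho0).
apply: null_subset (slice_image_null sc hc hyp) => v vb.
(* The point (0, v) of the slice chart is in N and has a preimage. *)
pose x : 'rV[R]_n.*2.+1 := \row_i (if unlift ord0 i is Some j then v ord0 j else 0).
have xb : ball (cmap c q) rho x.
  apply/rball_normE; apply: le_lt_trans ((rball_normE _ _ _).1 vb).
  apply: norm_le_coord => // i; rewrite !mxE; case: unliftP => [j ->|->].
    by apply: le_trans (coord_le_norm _ j); rewrite !mxE.
  by rewrite qz subrr normr0.
have xi := hrho x xb.
have [p fp] := rmap_surj S (cinv c x).
exists p; rewrite /= fp; last first.
  by rewrite (cinvK xi); apply/rowP => j; rewrite !mxE liftK.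
by split; [exact: cinv_dom|rewrite (cinvK xi) mxE unlift_none].
Qed.
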